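(* Let $k$ be an algebraically closed field of characteristic $0$, and let $X \subset \mathbb{P}^r$ be a smooth del Pezzo variety over $k$ of codimension $e \ge 3$, with homogeneous coordinate ring $S_X = S/I_X$, $S = k[x_0,\dots,x_r]$. Let $$F_\bullet:\ 0 \to F_e \xrightarrow{d_e} F_{e-1} \xrightarrow{d_{e-1}} \cdots \xrightarrow{d_2} F_1 \xrightarrow{d_1} F_0 = S$$ be the minimal graded free resolution of $S_X$ over $S$. Then one can choose homogeneous bases of the free modules $F_1, \dots, F_{e-1}$ such that, writing $d_2,\dots,d_{e-1}$ also for the matrices (with entries in $S_1$) of the differentials in these bases, the square matrix $$D_{e-1} = d_2 \wedge d_3 \wedge \cdots \wedge d_{e-1}$$ with entries in $\bigwedge^{e-2} S_1$, which represents the $(e-1)$-th linear syzygies among the quadrics defining $X$, is skew-symmetric, i.e. $D_{e-1}^{t} = -D_{e-1}$.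
   Context: Del Pezzo varieties. A smooth, non-degenerate projective variety $X \subset \mathbb{P}^r$ of dimension $n$ and codimension $e = r-n$ over an algebraically closed field $k$ of characteristic $0$ is called a del Pezzo variety if $\omega_X = \mathcal{O}_X(1-n)$; it is moreover taken to be arithmetically Gorenstein of degree $e+2$. Arithmetically Gorenstein here means that $F_\bullet$ has length $e$ and $\operatorname{Ext}^e_S(S_X, S(-r-1)) \simeq S_X(1-n)$ as graded $S$-modules. Here $S = k[x_0,\dots,x_r]$ has the standard grading, $S_1$ is its space of linear forms, $I_X \subset S$ is the homogeneous ideal of $X$, and $S_X = S/I_X$. Shape of the resolution. For such $X$ with $e\ge 3$, the minimal graded free resolution satisfies $F_0 = S$, $F_i = S(-i-1)^{\beta_{i,1}}$ for $1 \le i \le e-1$, and $F_e = S(-e-2)$, where $\beta_{p,1} = p\binom{e+1}{p+1} - \binom{e}{p-1}$. In particular $\beta_{1,1} = \beta_{e-1,1} = \binom{e+1}{2}-1$, and the matrices of $d_2, \dots, d_{e-1}$ in homogeneous bases have entries in $S_1$. Wedge product of matrices. If $A = (a_{ij})$ has entries in $\bigwedge^p S_1$ and $B = (b_{ij})$ has entries in $\bigwedge^q S_1$, with the number of columns of $A$ equal to the number of rows of $B$, then $A \wedge B$ is the matrix with $(i,j)$ entry $\sum_k a_{ik} \wedge b_{kj} \in \bigwedge^{p+q} S_1$. The matrix $D_p = d_2 \wedge \cdots \wedge d_p$ (for $2 \le p \le e-1$) is the $\beta_{1,1} \times \beta_{p,1}$ matrix with entries in $\bigwedge^{p-1} S_1$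 obtained in this way (so $D_2 = d_2$). Meaning of ''represents''. Let $Q_1, \dots, Q_N$ be the basis of $(I_X)_2$ given by $d_1$, where $N = \beta_{1,1}$. A column $(c_1, \dots, c_N)^t$ of $D_p$ corresponds to the element $\sum_i c_i \otimes Q_i$ of $K_{p-1,2}(I_X, S_1) = \ker\left[\bigwedge^{p-1} S_1 \otimes (I_X)_2 \to \bigwedge^{p-2} S_1 \otimes (I_X)_3\right]$ (the map being the Koszul differential), and the space of $p$-th linear syzygies $K_{p-1,2}(I_X,S_1)$ is the $k$-span of the elements coming from the columns of $D_p$. *)

(* Defs.v *)
From HB Require Import structures.
From mathcomp Require Import all_boot all_order all_algebra.
From mathcomp Require Export mpoly.

Set Implicit Arguments.
Unset Strict Implicit.
Unset Printing Implicit Defensive.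

Import GRing.Theory.
Local Open Scope ring_scope.

Notation polyS k r := {mpoly k[r.+1]}.

(* S_m for an integer m, so that shifted modules S(a)_m = S_(m + a) make sense
   in all degrees. *)
Definition zhomog (k : fieldType) (r : nat) (m : int) (f : polyS k r) : Prop :=
  match m with
  | Posz d => f \is d.-homog
  | Negz _ => f = 0
  end.

(* A subset of P^r is represented by the set of all homogeneous coordinate
   vectors of its points; the zero vector is never a member. *)
Definition hcoord (k : fieldType) (r : nat) : Type := 'I_r.+1 -> k.
Definition projset (k : fieldType) (r : nat) : Type := hcoord k r -> Prop.

Definition subproj (k : fieldType) (r : nat) (Y Z : projset k r) : Prop :=
  forall v, Y v -> Z v.

Definition proj_closed (k : fieldType) (r : nat) (Y : projset k r) : Prop :=
  exists T : polyS k r -> Prop,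
    (forall f, T f -> exists d : nat, f \is d.-homog) /\
    (forall v, Y v <->
       (exists i, v i != 0) /\ (forall f, T f -> f.@[v] = 0)).

Definition proj_variety (k : fieldType) (r : nat) (Y : projset k r) : Prop :=
  [/\ proj_closed Y,
      (exists v, Y v)
    & forall Y1 Y2, proj_closed Y1 -> proj_closed Y2 ->
        (forall v, Y v -> Y1 v \/ Y2 v) -> subproj Y Y1 \/ subproj Y Y2].

Definition irr_chain (k : fieldType) (r : nat) (X : projset k r) (m : nat)
    (Y : nat -> projset k r) : Prop :=
  (forall i, (i <= m)%N -> proj_variety (Y i) /\ subproj (Y i) X) /\
  (forall i, (i < m)%N -> subproj (Y i) (Y i.+1) /\ ~ subproj (Y i.+1) (Y i)).

Definition proj_dim (k : fieldType) (r : nat) (X : projset k r) (n : nat) : Prop :=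
  (exists Y, irr_chain X n Y) /\
  (forall m Y, irr_chain X m Y -> (m <= n)%N).

(* The homogeneous ideal I_X: the polynomials all of whose homogeneous
   components vanish on X. *)
Definition hideal (k : fieldType) (r : nat) (X : projset k r) : polyS k r -> Prop :=
  fun f => forall (d : nat) v, X v -> (pihomog mdeg d f).@[v] = 0.

Definition nondegenerate (k : fieldType) (r : nat) (X : projset k r) : Prop :=
  forall l : polyS k r, l \is 1.-homog -> hideal X l -> l = 0.

(* Jacobian criterion, in homogeneous coordinates. *)
Definition smooth_proj (k : fieldType) (r : nat) (X : projset k r) (n : nat) : Prop :=
  exists (t : nat) (f : 'I_t -> polyS k r),
    [/\ forall i, exists d : nat, f i \is d.-homog,
        forall h, hideal X h <->
          exists c : 'I_t -> polyS k r, h = \sum_i c i * f i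
      & forall v, X v ->
          (\rank (\matrix_(i < t, j < r.+1) ((f i)^`M(j)).@[v]) + n)%N = r].

(* dim_k (S / I)_m = h *)
Definition hilbert_value (k : fieldType) (r : nat) (I : polyS k r -> Prop)
    (m h : nat) : Prop :=
  exists u : 'I_h -> polyS k r,
    [/\ forall i, u i \is m.-homog,
        forall c : 'I_h -> k, I (\sum_i c i *: u i) -> forall i, c i = 0
      & forall f, f \is m.-homog ->
          exists c : 'I_h -> k, I (f - \sum_i c i *: u i)].

(* For X of dimension n: the Hilbert polynomial of S_X has leading term
   (dg / n!) t^n. *)
Definition proj_degree (k : fieldType) (r : nat) (X : projset k r)
    (n dg : nat) : Prop :=
  exists P : {poly rat},
    [/\ exists m0 : nat, forall m, (m0 <= m)%N ->
          exists2 h : nat, hilbert_value (hideal X) m h & P.[m%:R] = h%:R,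
        size P = n.+1
      & lead_coef P * n`!%:R = dg%:R].

(* The exterior algebra of R^m: u is the sum over A = {a_1 < ... < a_p} of
   u A *: (e_(a_1) /\ ... /\ e_(a_p)). *)
Notation exterior R m := {ffun {set 'I_m} -> R^o}.

Definition ext_degree (R : comNzRingType) (m p : nat) (u : exterior R m) : Prop :=
  forall A : {set 'I_m}, #|A| != p -> u A = 0.

(* e_A /\ e_B = wsign A B *: e_(A :|: B) for disjoint A and B. *)
Definition wsign (R : comNzRingType) (m : nat) (A B : {set 'I_m}) : R :=
  (-1) ^+ #|[set p : 'I_m * 'I_m | [&& p.1 \in A, p.2 \in B & (p.2 < p.1)%N]]|.

Definition wedge (R : comNzRingType) (m : nat) (u v : exterior R m) : exterior R m :=
  [ffun A : {set 'I_m} => \sum_(B : {set 'I_m} | B \subset A)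
     wsign R B (A :\: B) * u B * v (A :\: B)].

(* The Koszul differential over S, e_i |-> x_i, extended as an antiderivation;
   on differential forms (e_i = dx_i) this is contraction with the Euler field. *)
Definition koszul (k : fieldType) (r : nat) (u : exterior (polyS k r) r.+1) :
    exterior (polyS k r) r.+1 :=
  [ffun B : {set 'I_r.+1} => \sum_(i | i \notin B)
     wsign (polyS k r) [set i] B * 'X_i * u (i |: B)].

(* A graded S-module given as a subquotient of an S-module: its component of
   degree m is gm_cyc m modulo gm_bnd. *)
Record gmodule (k : fieldType) (r : nat) := GModule {
  gm_amb : lmodType (polyS k r);
  gm_cyc : int -> gm_amb -> Prop;
  gm_bnd : gm_amb -> Prop
}.

(* phi describes, on representatives, a family of k-linear isomorphisms
   M_m -> N_m, for all degrees m satisfying P, that commutes with the action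
   of S. *)
Definition giso_on (P : int -> Prop) (k : fieldType) (r : nat) (M N : gmodule k r)
    (phi : int -> gm_amb M -> gm_amb N) : Prop :=
  [/\ forall m, P m -> forall x, gm_cyc m x -> gm_cyc m (phi m x),
      forall m, P m -> forall x y, gm_cyc m x -> gm_cyc m y ->
        gm_bnd (phi m (x + y) - phi m x - phi m y),
      forall m (j : nat), P m -> P (m + j%:Z) ->
        forall (s : polyS k r) x, s \is j.-homog -> gm_cyc m x ->
        gm_bnd (phi (m + j%:Z) (s *: x) - s *: phi m x),
      forall m, P m -> forall x, gm_cyc m x -> (gm_bnd (phi m x) <-> gm_bnd x)
    & forall m, P m -> forall y, gm_cyc m y ->
        exists2 x, gm_cyc m x & gm_bnd (phi m x - y)].

Definition gmod_iso (k : fieldType) (r : nat) (M N : gmodule k r) : Prop :=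
  exists phi, @giso_on (fun _ => True) k r M N phi.

(* For finitely generated graded S-modules M and N, the associated coherent
   sheaves on P^r are isomorphic exactly when M and N are isomorphic in all
   sufficiently large degrees. *)
Definition sheaf_iso (k : fieldType) (r : nat) (M N : gmodule k r) : Prop :=
  exists (m0 : int) phi, @giso_on (fun m => (m0 <= m)%R) k r M N phi.

(* (S / I)(a) *)
Definition coord_module (k : fieldType) (r : nat) (I : polyS k r -> Prop)
    (a : int) : gmodule k r :=
  @GModule k r (polyS k r)^o (fun m f => zhomog (m + a) f) I.

(* The relations of the exterior algebra of Omega_(S_X / k) as a quotient of
   that of the free module on the dx_i: I and dI generate them. *)
Definition differential (k : fieldType) (r : nat) (f : polyS k r) :
    exterior (polyS k r) r.+1 :=
  [ffun A : {set 'I_r.+1} => \sum_i (if A == [set i] then f^`M(i) else 0)].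

Definition form_rel (k : fieldType) (r : nat) (I : polyS k r -> Prop)
    (u : exterior (polyS k r) r.+1) : Prop :=
  exists (t : nat) (f : 'I_t -> polyS k r)
         (th : 'I_t -> exterior (polyS k r) r.+1) (z : exterior (polyS k r) r.+1),
    [/\ forall l, I (f l), forall A, I (z A)
      & u = \sum_l wedge (differential (f l)) (th l) + z].

(* A graded module whose sheaf is the canonical sheaf of the smooth variety X
   of dimension n: a section of the n-th exterior power of Omega_X is a
   homogeneous n-form on the affine cone (where dx_i has degree 1) that is
   killed by contraction with the Euler field. *)
Definition canonical_module (k : fieldType) (r : nat) (X : projset k r) (n : nat) :
    gmodule k r :=
  @GModule k r (exterior (polyS k r) r.+1)
    (fun m u => [/\ ext_degree n u, forall A, zhomog (m - n%:Z) (u A)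
                  & form_rel (hideal X) (koszul u)])
    (form_rel (hideal X)).

(* F_i is the direct sum of the S(- fc_sh i b), b < fc_rk i, and fc_d i is the
   matrix of d_(i+1) : F_(i+1) -> F_i, acting on column vectors. *)
Record gfree_complex (k : fieldType) (r : nat) := GFreeComplex {
  fc_rk : nat -> nat;
  fc_sh : forall i, 'I_(fc_rk i) -> int;
  fc_d : forall i, 'M[polyS k r]_(fc_rk i, fc_rk i.+1)
}.

Definition minimal_free_resolution (k : fieldType) (r : nat)
    (I : polyS k r -> Prop) (F : gfree_complex k r) : Prop :=
  [/\ fc_rk F 0%N = 1%N /\ forall b : 'I_(fc_rk F 0%N), fc_sh b = 0,
      forall i a b, zhomog (@fc_sh k r F i.+1 b - @fc_sh k r F i a) (fc_d F i a b),
      forall f, I f <->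
        exists u : 'cV_(fc_rk F 1%N), forall a, (fc_d F 0%N *m u) a 0 = f,
      forall i (u : 'cV_(fc_rk F i.+1)),
        fc_d F i *m u = 0 <-> exists w, u = fc_d F i.+1 *m w
    & forall i a b, (fc_d F i a b)@_0%MM = 0].

Definition resolution_length (k : fieldType) (r : nat) (F : gfree_complex k r)
    (e : nat) : Prop :=
  (0 < fc_rk F e)%N /\ (forall i, (e < i)%N -> fc_rk F i = 0%N).

Definition coboundary (k : fieldType) (r : nat) (F : gfree_complex k r) (i : nat) :
    'rV[polyS k r]_(fc_rk F i) -> Prop :=
  match i with
  | 0 => fun u => u = 0
  | i'.+1 => fun u => exists w, u = w *m fc_d F i'
  end.

(* Ext^i_S(M, S(c)) as the i-th cohomology of Hom_S(F, S(c)), for F a graded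
   free resolution of M; homomorphisms F_i -> S(c) are row vectors. *)
Definition Ext_module (k : fieldType) (r : nat) (F : gfree_complex k r) (i : nat)
    (c : int) : gmodule k r :=
  @GModule k r 'rV[polyS k r]_(fc_rk F i)
    (fun m u => (forall b, zhomog (m + fc_sh b + c) (u 0 b)) /\ u *m fc_d F i = 0)
    (@coboundary k r F i).

(* F is the minimal graded free resolution of S_X. *)
Definition arith_Gorenstein (k : fieldType) (r : nat) (X : projset k r)
    (F : gfree_complex k r) (n e : nat) : Prop :=
  resolution_length F e /\
  gmod_iso (Ext_module F e (- r.+1%:Z)) (coord_module (hideal X) (1 - n%:Z)).

Record del_pezzo (k : fieldType) (r : nat) (X : projset k r)
    (F : gfree_complex k r) (n e : nat) : Prop := DelPezzo {
  dp_variety : proj_variety X;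
  dp_dim : proj_dim X n;
  dp_codim : r = (n + e)%N;
  dp_smooth : smooth_proj X n;
  dp_nondegenerate : nondegenerate X;
  dp_canonical :
    sheaf_iso (canonical_module X n) (coord_module (hideal X) (1 - n%:Z));
  dp_degree : proj_degree X n (e + 2);
  dp_Gorenstein : arith_Gorenstein X F n e
}.

(* The columns of g form a basis of F_i consisting of homogeneous elements. *)
Definition homogeneous_basis (k : fieldType) (r : nat) (F : gfree_complex k r)
    (i : nat) (g : 'M[polyS k r]_(fc_rk F i)) : Prop :=
  g \in unitmx /\
  exists t : 'I_(fc_rk F i) -> int, forall a b, zhomog (t b - fc_sh a) (g a b).

(* The matrix of d_(i+1) in the bases given by the columns of g i and g i.+1. *)
Definition rebased (k : fieldType) (r : nat) (F : gfree_complex k r)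
    (g : forall i, 'M[polyS k r]_(fc_rk F i)) (i : nat) :
    'M[polyS k r]_(fc_rk F i, fc_rk F i.+1) :=
  invmx (g i) *m fc_d F i *m g i.+1.

(* S_1 as the degree one part of the exterior algebra of S_1 = k^(r+1), with
   basis x_0, ..., x_r. *)
Definition linear_ext (k : fieldType) (r : nat) (l : polyS k r) : exterior k r.+1 :=
  [ffun A : {set 'I_r.+1} => \sum_i (if A == [set i] then l@_(U_(i)%MM) else 0)].

Definition wedge_mx (R : comNzRingType) (m a b c : nat)
    (A : 'M[exterior R m]_(a, b)) (B : 'M[exterior R m]_(b, c)) :
    'M[exterior R m]_(a, c) :=
  \matrix_(i, j) \sum_l wedge (A i l) (B l j).

(* D_p = d_2 /\ ... /\ d_p for p >= 2, where d i is the matrix of d_(i+1);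
   the values at p = 0, 1 are irrelevant. *)
Fixpoint wedge_syz (k : fieldType) (r : nat) (b : nat -> nat)
    (d : forall i, 'M[polyS k r]_(b i, b i.+1)) (p : nat) :
    'M[exterior k r.+1]_(b 1%N, b p) :=
  match p with
  | 0 => 0
  | p'.+1 =>
    match p' return 'M[exterior k r.+1]_(b 1%N, b p') ->
                    'M[exterior k r.+1]_(b 1%N, b p'.+1) with
    | 0 => fun _ => 0
    | 1 => fun _ => map_mx (@linear_ext k r) (d 1%N)
    | q => fun D => wedge_mx D (map_mx (@linear_ext k r) (d q))
    end (wedge_syz d p')
  end.

Definition degree_basis (k : fieldType) (r N : nat) (I : polyS k r -> Prop)
    (q : nat) (Q : 'I_N -> polyS k r) : Prop :=
  [/\ forall i, I (Q i) /\ Q i \is q.-homog,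
      forall c : 'I_N -> k, \sum_i c i *: Q i = 0 -> forall i, c i = 0
    & forall f, I f -> f \is q.-homog -> exists c : 'I_N -> k, f = \sum_i c i *: Q i].

(* K_(p,2)(I, S_1), for I without linear forms, where the tensor product of
   the p-th exterior power of S_1 and I_2 is seen inside the exterior algebra
   of S^(r+1). *)
Definition koszul_cycle (k : fieldType) (r : nat) (I : polyS k r -> Prop) (p : nat)
    (w : exterior (polyS k r) r.+1) : Prop :=
  [/\ ext_degree p w,
      forall A, I (w A) /\ (w A : polyS k r) \is 2.-homog
    & koszul w = 0].

(* sum_i c_i (x) Q_i *)
Definition syzygy_of_col (k : fieldType) (r N : nat) (Q : 'I_N -> polyS k r)
    (c : 'cV[exterior k r.+1]_N) : exterior (polyS k r) r.+1 :=
  [ffun A => \sum_i (c i 0 A : k) *: Q i].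

Definition represents_linear_syzygies (k : fieldType) (r N M : nat)
    (I : polyS k r -> Prop) (Q : 'I_N -> polyS k r) (p : nat)
    (D : 'M[exterior k r.+1]_(N, M)) : Prop :=
  degree_basis I 2 Q /\
  forall w, koszul_cycle I p.-1 w <->
    exists c : 'I_M -> k,
      w = \sum_j (c j)%:MP_[r.+1] *: syzygy_of_col Q (col j D).

(* Main.v *)
Require Import Defs.
From HB Require Import structures.
From mathcomp Require Import all_boot all_order all_algebra.
From mathcomp Require Import mpoly ring zify.
From Stdlib Require Import ClassicalEpsilon.

Set Implicit Arguments.
Unset Strict Implicit.
Unset Printing Implicit Defensive.


Import GRing.Theory.
Local Open Scope ring_scope.

(** The minimal resolution of a Gorenstein coordinate ring is self-dual.  Sliding
the self-duality through the product of the matrices of the resolution shows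
that D is symmetric or skew-symmetric in suitable bases, and it cannot be
symmetric because the product of all the differentials of the entries of the
matrices, which has the shape q D q^t with q a row of 1-forms, is nonzero.

Self-duality.  The isomorphism of Ext^e(S_X, S) with a twist of S_X says that
F_e is S(-e-2) and that the entries of d_e generate I_X ([gorenstein_top]).
Multiplication by an element of I_X is null-homotopic on F, so these entries
kill all the Ext^i(S_X, S).  Going down from a cocycle z : F_i -> F_e along the
exact complex F then shows that Ext^i(S_X, S) = 0 for i < e ([coexact_le]): if
N is the first nonzero Ext^i, it embeds in a module C of projective dimension
i < e, so Tor_e(S_X, N) embeds in Tor_e(S_X, C) = 0, although Tor_e(S_X, N) = N.
Hence the dual of F is exact too.  The degrees of the generators increase
strictly along F and along its dual, and since I_X contains no linear form the
two bounds meet: F_i is generated in degree i+1 for 0 < i < e ([sh_eq]).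
The identity of S_X lifts to a chain map from the dual of F to F; degrees allow
constant matrices only ([dual_map_chain]).  Such a map is determined by its
component in degree 0, so it is equal to its transpose up to a scalar of square
one ([dual_map_sym]).

Symmetry up to sign.  D is a product of matrices of 1-forms.  Moving the chain
map from the right end of the product to the left end replaces each factor by
the transpose of the opposite one; as 1-forms anticommute, the result is the
transpose of D up to sign ([dprod_reversal], [socle_form_sym_or_skew]).

The sign.  Let q be the row of the differentials of the quadrics.  If D were
symmetric, exchanging the two outer factors of q D q^t would change its sign
([quadratic_form_alternates]), so that it would vanish.  But up to a unit it is
the product of the differentials of d_1, ..., d_e, and in characteristic 0 this
form is a cycle of the Koszul complex with values in S_X that represents the
generator of Tor_e(S_X, k).  Indeed Euler's formula gives
  contract (delta_a ... delta_b) = c d_a delta_(a+1) ... delta_b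
with c a positive integer ([contract_dprod]), and with the exactness of F this
forces a nonzero constant into the maximal ideal as soon as the product vanishes
([dprod_not_null_homotopic]).

Syzygies.  The same identity shows that the columns of D give Koszul cycles.
Conversely a cycle lifts step by step along F to constants, and since the
contraction is injective on constant forms of positive degree, each lift has to
be a product of matrices of 1-forms ([constant_syzygy_dprod]). *)

(** * The exterior algebra as a ring *)

Section Sign.
Variables (R : comNzRingType) (m : nat).
Implicit Types A B C : {set 'I_m}.

(** As a product over pairs, the sign is multiplicative in both arguments, which
is all that associativity needs. *)
Lemma wsign_prod A B :
  wsign R A B = \prod_(a in A) \prod_(b in B) (-1) ^+ (b < a)%N.
Proof.
rewrite /wsign -sum1_card.
transitivity ((-1) ^+ (\sum_(a in A) \sum_(b in B) (b < a)%N) : R).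
  congr (_ ^+ _); rewrite pair_big_dep /= big_mkcond [RHS]big_mkcond /=.
  apply: eq_bigr => -[a b] _; rewrite inE /=.
  rewrite andbA if_and; case: (X in if X then _ else _) => //; case: leq.
rewrite expr_sum; apply: eq_bigr => a _; exact: expr_sum.
Qed.

Lemma prod_setU_disjoint (F : 'I_m -> R) A B : [disjoint A & B] ->
  \prod_(i in A :|: B) F i = (\prod_(i in A) F i) * (\prod_(i in B) F i).
Proof. by move=> AB; rewrite -bigU //; apply: eq_bigl => i; rewrite !inE. Qed.

Lemma wsign_setUl A B C : [disjoint A & B] ->
  wsign R (A :|: B) C = wsign R A C * wsign R B C.
Proof. by move=> AB; rewrite !wsign_prod prod_setU_disjoint. Qed.

Lemma wsign_setUr A B C : [disjoint B & C] ->
  wsign R A (B :|: C) = wsign R A B * wsign R A C.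
Proof.
move=> BC; rewrite !wsign_prod -big_split /=; apply: eq_bigr => a _.
exact: prod_setU_disjoint.
Qed.

Lemma wsign0l B : wsign R set0 B = 1.
Proof. by rewrite wsign_prod big_set0. Qed.

Lemma wsign0r B : wsign R B set0 = 1.
Proof. by rewrite wsign_prod big1 // => a _; rewrite big_set0. Qed.

Lemma wsign_sqr A B : wsign R A B * wsign R A B = 1.
Proof. by rewrite /wsign -exprD addnn -muln2 mulnC exprM sqrrN !expr1n. Qed.

Lemma wsign1 (i j : 'I_m) : wsign R [set i] [set j] = (-1) ^+ (j < i)%N.
Proof. by rewrite wsign_prod !big_set1. Qed.

Lemma wsign_swap1 (i j : 'I_m) : i != j ->
  wsign R [set i] [set j] = - wsign R [set j] [set i].
Proof.
rewrite !wsign1 neq_ltn => /orP[] lt_ij.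
  by rewrite lt_ij (ltnNge j i) (ltnW lt_ij) expr1 opprK.
by rewrite lt_ij (ltnNge i j) (ltnW lt_ij).
Qed.

End Sign.

(** A copy of the type of exterior forms, on which the ring structure is the wedge
product and not the pointwise product of finite functions; wedge products of
matrices become ordinary products of matrices. *)
Definition extalg (R : comNzRingType) (m : nat) : Type := exterior R m.

Section ExteriorRing.
Variables (R : comNzRingType) (m : nat).
Implicit Types (A B C : {set 'I_m}) (u v w : exterior R m).

HB.instance Definition _ := GRing.Lmodule.copy (extalg R m) (exterior R m).

Definition ext_one : exterior R m := [ffun A => (A == set0)%:R].

Lemma wedgeE u v A :
  wedge u v A = \sum_(B : {set 'I_m} | B \subset A) wsign R B (A :\: B) * u B * v (A :\: B).
Proof. by rewrite ffunE. Qed.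

Lemma setUDK A B : B \subset A -> B :|: A :\: B = A.
Proof.
move=> BA; apply/setP => x; rewrite !inE.
by case: (boolP (x \in B)) => //= /(subsetP BA) ->.
Qed.

Lemma wedgeA : associative (@wedge R m).
Proof.
move=> u v w; apply/ffunP => A; rewrite !wedgeE.
under eq_bigr => B BA do rewrite wedgeE mulr_sumr.
under [RHS]eq_bigr => D DA do rewrite wedgeE mulr_sumr mulr_suml.
rewrite [RHS](exchange_big_dep (fun B : {set 'I_m} => B \subset A)) /=; last first.
  by move=> D B DA BD; apply: subset_trans BD DA.
apply: eq_bigr => B BA.
rewrite [RHS](reindex_onto (fun C => B :|: C) (fun D => D :\: B)) /=; last first.
  by move=> D /andP[DA BD]; apply: setUDK.
have DUB C : (B :|: C) :\: B = C :\: B by rewrite setDUl setDv set0U.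
apply: eq_big => [C|C].
  by rewrite subUset BA subsetUl andbT /= DUB subsetD; congr (_ && _); apply/setDidPl/eqP.
rewrite subsetD => /andP[CA CB].
have BC : [disjoint B & C] by rewrite disjoint_sym.
rewrite DUB (setDidPl CB) -setDDl.
set D := A :\: B :\: C; rewrite (wsign_setUl _ _ BC).
have -> : A :\: B = C :|: D by rewrite setUDK // subsetD CA.
rewrite wsign_setUr; last by rewrite disjoint_sym disjoints_subset; apply/subsetP => x; rewrite !inE => /andP[].
ring.
Qed.

Lemma mul1w : left_id ext_one (@wedge R m).
Proof.
move=> u; apply/ffunP => A; rewrite wedgeE (bigD1 set0) ?sub0set //=.
rewrite big1 => [|B /andP[_ /negPf B0]]; last by rewrite ffunE B0 mulr0 mul0r.
by rewrite ffunE eqxx setD0 wsign0l !mul1r addr0.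
Qed.

Lemma mulw1 : right_id ext_one (@wedge R m).
Proof.
move=> u; apply/ffunP => A; rewrite wedgeE (bigD1 A) //= big1 => [|B /andP[BA nBA]].
  by rewrite ffunE setDv eqxx wsign0r mul1r mulr1 addr0.
rewrite ffunE setD_eq0; case: (boolP (A \subset B)) => AB; last by rewrite mulr0.
by move: nBA; rewrite eqEsubset BA AB.
Qed.

Lemma wedgeDl : left_distributive (@wedge R m) +%R.
Proof.
move=> u v w; apply/ffunP => A; rewrite [RHS]ffunE !wedgeE -big_split /=.
by apply: eq_bigr => B _; rewrite ffunE mulrDr mulrDl.
Qed.

Lemma wedgeDr : right_distributive (@wedge R m) +%R.
Proof.
move=> u v w; apply/ffunP => A; rewrite [RHS]ffunE !wedgeE -big_split /=.
by apply: eq_bigr => B _; rewrite ffunE mulrDr.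
Qed.

Lemma ext_one_neq0 : ext_one != 0.
Proof.
by apply/eqP => /ffunP /(_ set0); rewrite !ffunE eqxx => /eqP; rewrite oner_eq0.
Qed.

HB.instance Definition _ := GRing.Zmodule_isNzRing.Build (extalg R m)
  wedgeA mul1w mulw1 wedgeDl wedgeDr ext_one_neq0.

Lemma wedgeZl (a : R) u v : a *: wedge u v = wedge (a *: u) v.
Proof.
apply/ffunP => A; rewrite [LHS]ffunE !wedgeE scaler_sumr.
by apply: eq_bigr => B _; rewrite ffunE /GRing.scale /=; ring.
Qed.

Lemma wedgeZr (a : R) u v : a *: wedge u v = wedge u (a *: v).
Proof.
apply/ffunP => A; rewrite [LHS]ffunE !wedgeE scaler_sumr.
by apply: eq_bigr => B _; rewrite ffunE /GRing.scale /=; ring.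
Qed.

HB.instance Definition _ := GRing.Lmodule_isLalgebra.Build R (extalg R m) wedgeZl.
HB.instance Definition _ := GRing.Lalgebra_isAlgebra.Build R (extalg R m) wedgeZr.

End ExteriorRing.

(** * Contraction with the Euler field *)

Section Generators.
Variables (R : comNzRingType) (m : nat).
Local Notation E := (extalg R m).
Implicit Types (A B : {set 'I_m}) (u v : E) (i j : 'I_m).

Definition egen i : E := [ffun A : {set 'I_m} => (A == [set i])%:R] : exterior R m.

Lemma extME u v A : (u * v) A =
  \sum_(B : {set 'I_m} | B \subset A) wsign R B (A :\: B) * u B * v (A :\: B).
Proof. exact: wedgeE. Qed.

Lemma egenM i u A :
  (egen i * u) A = if i \in A then wsign R [set i] (A :\ i) * u (A :\ i) else 0.
Proof.
rewrite extME; case: ifP => iA.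
  rewrite (bigD1 [set i]) ?sub1set //= big1 => [|B /andP[_ /negPf B0]].
    by rewrite ffunE eqxx mulr1 addr0.
  by rewrite ffunE B0 mulr0 mul0r.
apply: big1 => B BA; rewrite ffunE; case: eqP => [Bi|_]; last by rewrite mulr0 mul0r.
by move: BA; rewrite Bi sub1set iA.
Qed.

Lemma extZE (a : R) u A : (a *: u) A = a * u A.
Proof. by rewrite ffunE. Qed.

Lemma extDE u v A : (u + v) A = u A + v A.
Proof. by rewrite ffunE. Qed.

Lemma extNE u A : (- u) A = - u A.
Proof. by rewrite ffunE. Qed.

Lemma ext_sumE (I : Type) (s : seq I) (P : pred I) (F : I -> E) A :
  (\sum_(x <- s | P x) F x) A = \sum_(x <- s | P x) F x A.
Proof. by apply: (big_morph (fun u : E => u A)) => [u v|]; rewrite ffunE. Qed.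

Lemma egen_anticomm i j : egen i * egen j = - (egen j * egen i).
Proof.
have sq l : egen l * egen l = 0.
  apply/ffunP => A; rewrite egenM [RHS]ffunE; case: ifP => // lA.
  rewrite ffunE; case: eqP => [Al|_]; last by rewrite mulr0.
  by have := set11 l; rewrite -Al !inE eqxx.
have [->|ij] := eqVneq i j; first by rewrite sq oppr0.
have supp l h A : l != h -> (egen l * egen h) A =
    if A == [set l; h] then wsign R [set l] [set h] else 0.
  move=> lh; rewrite egenM ffunE; case: (A =P _) => [->|nA].
    rewrite !inE eqxx /=.
    have -> : [set l; h] :\ l = [set h].
      by rewrite setU1K // !inE.
    by rewrite eqxx mulr1.
  case: ifP => // lA; case: eqP => [Ah|_]; last by rewrite mulr0.
  by case: nA; rewrite -(setD1K lA) Ah.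
apply/ffunP => A; have ji : j != i by rewrite eq_sym.
rewrite extNE (supp i j A ij) (supp j i A ji) (setUC [set j]); case: ifP => _; last by rewrite oppr0.
exact: wsign_swap1.
Qed.

End Generators.

Section Koszul.
Variables (k : fieldType) (r : nat).
Local Notation S := (polyS k r).
Local Notation E := (extalg S r.+1).
Implicit Types (f g : S) (u v : E) (A B : {set 'I_r.+1}).

Definition contract (u : E) : E := koszul u.

Lemma contractE u B :
  contract u B = \sum_(i | i \notin B) wsign S [set i] B * 'X_i * u (i |: B).
Proof. by rewrite ffunE. Qed.

Lemma contract_is_linear : linear contract.
Proof.
move=> a u v; apply/ffunP => B; rewrite extDE extZE !contractE mulr_sumr -big_split /=.
by apply: eq_bigr => i _; rewrite extDE extZE; ring.
Qed.
HB.instance Definition _ := GRing.isLinear.Build S E E _ contract contract_is_linear.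

Lemma contract1 : contract 1 = 0.
Proof.
apply/ffunP => B; rewrite contractE [RHS]ffunE big1 // => i _.
rewrite ffunE; case: eqP => [/setP /(_ i)|]; last by rewrite mulr0.
by rewrite !inE eqxx.
Qed.

(** The antiderivation rule for a generator e_i.  The term of index i of the
contraction produces 'X_i u; the others differ from those of e_i (contract u) by
the sign of exchanging e_i and e_j. *)
Lemma contract_egen i u :
  contract (egen S i * u) = 'X_i *: u - egen S i * contract u.
Proof.
apply/ffunP => B; rewrite extDE extNE extZE egenM (contractE (egen S i * u)) .
have [iB|niB] := boolP (i \in B); last first.
  rewrite subr0 (bigD1 i) //= big1 => [|j /andP[_ ji]]; last first.
    by rewrite egenM !inE eq_sym (negPf ji) (negPf niB) mulr0.
  rewrite egenM !inE eqxx /= setU1K //= addr0.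
  by rewrite mulrCA !mulrA wsign_sqr mul1r.
rewrite (contractE u) [X in _ - _ * X](bigD1 i) ?setD11 //= setD1K // mulrDr.
rewrite !mulrA wsign_sqr mul1r opprD addrA subrr add0r mulr_sumr -sumrN.
have jP j : (j \notin B :\ i) && (j != i) = (j \notin B).
  by rewrite !inE; case: eqP => [->|//]; rewrite ?iB //= andbT.
rewrite (eq_bigl _ _ jP); apply: eq_bigr => j jB.
have ji : j != i by apply: contraNneq jB => ->.
rewrite egenM !inE iB orbT.
have -> : (j |: B) :\ i = j |: B :\ i.
  by apply/setP => x; rewrite !inE; case: (eqVneq x j) => [->|]; rewrite ?ji.
have {1}-> : B = i |: B :\ i by rewrite setD1K.
rewrite !wsign_setUr ?disjoints1 ?inE ?eqxx ?(negPf jB) ?andbF //.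
have cancel (a b c x y : S) : a * a = 1 ->
    - a * b * x * (a * c * y) = - (c * (b * x * y)).
  by move=> a2; rewrite -[RHS]mul1r -a2; ring.
by rewrite (wsign_swap1 _ ji); apply: cancel; apply: wsign_sqr.
Qed.

Definition diff (f : S) : E := differential f.

Lemma diffE f : diff f = \sum_i f^`M(i) *: egen S i.
Proof.
apply/ffunP => A; rewrite ext_sumE ffunE; apply: eq_bigr => i _.
by rewrite extZE ffunE; case: eqP; rewrite ?mulr1 ?mulr0.
Qed.

(** Euler's formula for homogeneous polynomials, checked on monomials. *)
Lemma euler d f : f \is d.-homog -> \sum_i 'X_i * f^`M(i) = d%:R * f.
Proof.
move=> fd; rewrite {1 2}[f]mpolyE mulr_sumr.
under eq_bigr => i _ do rewrite raddf_sum mulr_sumr.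
rewrite exchange_big /=; apply: eq_big_seq => m mf.
have -> : d = (\sum_i m i)%N.
  by rewrite -mdegE; apply: esym; move/dhomogP: fd; apply.
rewrite natr_sum mulr_suml; apply: eq_bigr => i _.
rewrite linearZ /= mderivX -!scalerAr; congr (_ *: _).
have [->|mi] := posnP (m i); first by rewrite scale0r mul0r.
rewrite -mpolyXD addmC submK ?mulr_natl ?scaler_nat //.
by apply/mnm_lepP => j; rewrite mnm1E; case: eqP => // <-.
Qed.

(** The differential of a homogeneous polynomial contracts to a multiple of the
polynomial, so that [contract] undoes [diff]; this is where degrees, and later
the characteristic, enter. *)
Lemma contract_diff d f u : f \is d.-homog ->
  contract (diff f * u) = (d%:R * f) *: u - diff f * contract u.
Proof.
move=> fd; rewrite -(euler fd) diffE !mulr_suml scaler_suml raddf_sum -sumrB /=.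
by apply: eq_bigr => i _; rewrite -!scalerAl linearZ /= contract_egen scalerBr scalerA mulrC.
Qed.

Lemma diff_is_additive : zmod_morphism diff.
Proof.
move=> f g; rewrite !diffE -sumrB; apply: eq_bigr => i _.
by rewrite mderivB scalerBl.
Qed.
HB.instance Definition _ := GRing.isZmodMorphism.Build S E diff diff_is_additive.

Lemma diffM f g : diff (f * g) = g *: diff f + f *: diff g.
Proof.
rewrite !diffE !scaler_sumr -big_split /=; apply: eq_bigr => i _.
by rewrite mderivM scalerDl !scalerA [g * _]mulrC.
Qed.

Lemma diffC (c : k) : diff c%:MP = 0.
Proof. by rewrite diffE big1 // => i _; rewrite mderivC scale0r. Qed.

Lemma diff_mull f u : diff f * u = \sum_i f^`M(i) *: (egen S i * u).
Proof.
rewrite diffE mulr_suml; apply: eq_bigr => i _.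
by rewrite scalerAl.
Qed.

Lemma diff_mulr f u : u * diff f = \sum_i f^`M(i) *: (u * egen S i).
Proof.
rewrite diffE mulr_sumr; apply: eq_bigr => i _.
by rewrite scalerAr.
Qed.

Lemma diff_anticomm f g : diff f * diff g = - (diff g * diff f).
Proof.
rewrite diff_mull [in RHS]diff_mulr -[RHS]sumrN; apply: eq_bigr => i _.
rewrite diff_mulr [in RHS]diff_mull -scalerN -sumrN; congr (_ *: _).
by apply: eq_bigr => j _; rewrite egen_anticomm scalerN.
Qed.

Lemma alternating_sum (V : zmodType) (n : nat) (F : 'I_n -> 'I_n -> V) :
  (forall i j, F i j = - F j i) -> (forall i, F i i = 0) ->
  \sum_i \sum_j F i j = 0.
Proof.
move=> Fanti F0.
have splitF i : \sum_j F i j =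
    \sum_(j : 'I_n | (i < j)%N) F i j + \sum_(j : 'I_n | (j < i)%N) F i j.
  rewrite (bigID (fun j : 'I_n => (i < j)%N)) /=; congr (_ + _).
  rewrite (bigD1 i) ?ltnn //= F0 add0r; apply: eq_bigl => j.
  by rewrite -leqNgt ltn_neqAle andbC.
under eq_bigr => i _ do rewrite splitF.
rewrite big_split /= [X in _ + X](exchange_big_dep xpredT) //= -big_split /=.
apply: big1 => i _; rewrite -big_split big1 // => j _.
by rewrite /= Fanti addNr.
Qed.

Lemma contract_contract u : contract (contract u) = 0.
Proof.
apply/ffunP => B; rewrite contractE [RHS]ffunE.
pose F i j := if [&& i \notin B, j \notin B & i != j] then
   wsign S [set i] B * 'X_i * (wsign S [set j] (i |: B) * 'X_j * u (j |: (i |: B))) else 0.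
rewrite -[RHS](@alternating_sum _ _ F); first 1 last.
- move=> i j; rewrite /F andbCA eq_sym; case: ifP; rewrite ?oppr0 // => /and3P[iB jB ij].
  have swap (a b c x y z : S) : a * x * (- b * c * y * z) = - (c * y * (b * a * x * z)).
    by ring.
  rewrite !wsign_setUr ?disjoints1 // (wsign_swap1 _ ij) setUCA; exact: swap.
- by move=> i; rewrite /F eqxx !andbF.
rewrite big_mkcond /=; apply: eq_bigr => i _; rewrite /F.
case: ifP => iB; last by rewrite big1.
rewrite contractE mulr_sumr big_mkcond /=; apply: eq_bigr => j _.
by rewrite !inE negb_or andbC eq_sym.
Qed.

End Koszul.

(** * Forms with constant coefficients *)

Section Constants.
Variables (k : fieldType) (r : nat).
Local Notation S := (polyS k r).
Local Notation E := (extalg S r.+1).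
Local Notation Ek := (extalg k r.+1).
Implicit Types (u v : Ek) (A B : {set 'I_r.+1}).

Definition const_ext (u : Ek) : E := [ffun A : {set 'I_r.+1} => (u A)%:MP_[r.+1]] : exterior S r.+1.

Lemma const_extE u A : const_ext u A = (u A)%:MP.
Proof. by rewrite ffunE. Qed.

Lemma const_ext_is_additive : zmod_morphism const_ext.
Proof.
by move=> u v; apply/ffunP => A; rewrite extDE extNE !const_extE extDE extNE mpolyCB.
Qed.

Lemma const_ext_is_multiplicative : monoid_morphism const_ext.
Proof.
split=> [|u v]; apply/ffunP => A.
  by rewrite const_extE !ffunE mpolyC_nat.
rewrite const_extE !extME [LHS](raddf_sum (@mpolyC r.+1 k)).
apply: eq_bigr => B _; rewrite !const_extE /= !mpolyCM; congr (_ * _ * _).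
by rewrite /wsign rmorphXn rmorphN1.
Qed.

HB.instance Definition _ := GRing.isZmodMorphism.Build Ek E const_ext const_ext_is_additive.
HB.instance Definition _ := GRing.isMonoidMorphism.Build Ek E const_ext const_ext_is_multiplicative.

Lemma const_ext_inj : injective const_ext.
Proof.
move=> u v /ffunP uv; apply/ffunP => A.
by have := uv A; rewrite !const_extE => /(can_inj (@mpolyCK _ _)).
Qed.

(** The coefficient of 'X_i in the component A :\ i of the contraction is, up to
sign, the component A of the form. *)
Lemma contract_const_inj u : u set0 = 0 -> contract (const_ext u) = 0 -> u = 0.
Proof.
move=> u0 /ffunP cu; apply/ffunP => A; rewrite [RHS]ffunE.
have [->//|[i iA]] := set_0Vmem A.
have := congr1 (mcoeff U_(i)%MM) (cu (A :\ i)); rewrite contractE raddf_sum ffunE.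
rewrite mcoeff0 (bigD1 i) ?setD11 //= big1 => [|j /andP[_ ji]].
  rewrite const_extE setD1K // addr0 mulrC mcoeffCM /wsign; set n := #|_|.
  by rewrite -signr_odd; case: odd; rewrite ?mulN1r ?mul1r ?mcoeffN mcoeffX eqxx ?mulrN mulr1 // => /eqP; rewrite oppr_eq0 => /eqP.
rewrite const_extE mulrC mcoeffCM /wsign; set n := #|_|.
rewrite -signr_odd; case: odd; rewrite ?mulN1r ?mul1r ?mcoeffN mcoeffX.
  by rewrite eq_mnm1 (negPf ji) oppr0 mulr0.
by rewrite eq_mnm1 (negPf ji) mulr0.
Qed.

Lemma const_linear_ext (l : S) : l \is 1.-homog -> const_ext (linear_ext l) = diff l.
Proof.
move=> l1; rewrite diffE; apply/ffunP => A.
rewrite const_extE ext_sumE ffunE [LHS](raddf_sum (@mpolyC r.+1 k)); apply: eq_bigr => i _ /=.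
rewrite extZE ffunE; case: eqP => _; last by rewrite mulr0 mpolyC0.
rewrite mulr1; apply/mpolyP => m; rewrite mcoeff_deriv mcoeffC.
have [->|m0] := eqVneq m 0%MM; first by rewrite add0m mnm0E mulr1.
rewrite mulr0 (dhomog_nemf_coeff l1) ?mul0rn //= mdegD mdeg1 addn1 eqSS.
by rewrite mdeg_eq0.
Qed.

End Constants.

(** * Products of the differentials of a complex *)

Section ChainProduct.
Variables (S : Type) (E : nzRingType) (diff : S -> E).
Local Notation diff_mx := (map_mx diff).
Variables (rk : nat -> nat) (d : forall i, 'M[S]_(rk i, rk i.+1)).

(** The product of the matrices of differentials of d a, ..., d b.-1.  Both ends
are free indices, so that it can be extended on either side without transport
along equalities of dimensions; the Kronecker matrix is the identity for a = b
and a dummy value for a > b. *)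
Fixpoint dprod a b : 'M[E]_(rk a, rk b) :=
  match b with
  | 0 => \matrix_(i, j) (i == j :> nat)%:R
  | b'.+1 => if (a <= b')%N then dprod a b' *m diff_mx (d b')
             else \matrix_(i, j) (i == j :> nat)%:R
  end.

Lemma dprodnn a : dprod a a = 1%:M.
Proof. by case: a => [|a] /=; rewrite ?ltnn; apply/matrixP => i j; rewrite !mxE. Qed.

Lemma dprodSr a b : (a <= b)%N -> dprod a b.+1 = dprod a b *m diff_mx (d b).
Proof. by move=> /= ->. Qed.

Lemma dprodSl a b : (a < b)%N -> dprod a b = diff_mx (d a) *m dprod a.+1 b.
Proof.
elim: b => // b IHb; rewrite ltnS leq_eqVlt => /orP[/eqP <-|ab].
  by rewrite dprodSr // !dprodnn mul1mx mulmx1.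
by rewrite !dprodSr ?(ltnW ab) // IHb // mulmxA.
Qed.

End ChainProduct.

Lemma map_dprod (S : Type) (E1 E2 : nzRingType) (f : {rmorphism E1 -> E2})
    (diff1 : S -> E1) (diff2 : S -> E2) (rk : nat -> nat)
    (d : forall i, 'M[S]_(rk i, rk i.+1)) a b :
  (a <= b)%N ->
  (forall i, (a <= i < b)%N -> forall s t, f (diff1 (d i s t)) = diff2 (d i s t)) ->
  map_mx f (dprod diff1 d a b) = dprod diff2 d a b.
Proof.
elim: b => [|b IHb]; first by rewrite leqn0 => /eqP-> _; rewrite !dprodnn map_mx1.
rewrite leq_eqVlt => /orP[/eqP->|]; first by rewrite !dprodnn map_mx1.
rewrite ltnS => ab fd; rewrite !dprodSr // map_mxM IHb // => [|i /andP[ai ib]]; last first.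
  by apply: fd; rewrite ai ltnW.
congr (_ *m _); apply/matrixP => i j; rewrite !mxE; apply: fd.
by rewrite ab ltnSn.
Qed.

Section Matrices.
Variables (S : comNzRingType) (E : algType S).
Variables (contract : {linear E -> E}) (diff : {additive S -> E}).
Local Notation "[ A ]E" := (map_mx (in_alg E) A) (format "[ A ]E").
Local Notation contract_mx := (map_mx contract).
Local Notation diff_mx := (map_mx diff).
Hypothesis contract1 : contract 1 = 0.
Hypothesis diffM : forall f g, diff (f * g) = g *: diff f + f *: diff g.
Variable of_deg : nat -> S -> Prop.
Hypothesis contract_diff : forall t f u, of_deg t f ->
  contract (diff f * u) = (t%:R * f) *: u - diff f * contract u.

Lemma in_alg_mulmxE p q s (A : 'M[S]_(p, q)) (U : 'M[E]_(q, s)) i j :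
  ([A]E *m U) i j = \sum_l A i l *: U l j.
Proof. by rewrite mxE; apply: eq_bigr => l _; rewrite mxE mulr_algl. Qed.

Lemma contract_in_alg p q s (A : 'M[S]_(p, q)) (U : 'M[E]_(q, s)) :
  contract_mx ([A]E *m U) = [A]E *m contract_mx U.
Proof.
apply/matrixP => i j; rewrite mxE !in_alg_mulmxE raddf_sum.
by apply: eq_bigr => l _; rewrite /= linearZ_LR mxE.
Qed.

Lemma mulmx_in_algE p q s (U : 'M[E]_(p, q)) (A : 'M[S]_(q, s)) i j :
  (U *m [A]E) i j = \sum_l A l j *: U i l.
Proof. by rewrite mxE; apply: eq_bigr => l _; rewrite mxE mulr_algr. Qed.

Lemma contract_mul_in_alg p q s (U : 'M[E]_(p, q)) (A : 'M[S]_(q, s)) :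
  contract_mx (U *m [A]E) = contract_mx U *m [A]E.
Proof.
apply/matrixP => i j; rewrite mxE !mulmx_in_algE raddf_sum.
by apply: eq_bigr => l _; rewrite /= linearZ_LR mxE.
Qed.

Lemma contract_in_alg0 p q (A : 'M[S]_(p, q)) : contract_mx [A]E = 0.
Proof. by apply/matrixP => i j; rewrite !mxE linearZ /= contract1 scaler0. Qed.

Lemma mulmxMnr p q s (A : 'M[E]_(p, q)) (U : 'M[E]_(q, s)) n :
  A *m (U *+ n) = (A *m U) *+ n.
Proof. by elim: n => [|n IHn]; rewrite ?mulmx0 // !mulrS mulmxDr IHn. Qed.

Lemma contract_diff_mx t p q s (A : 'M[S]_(p, q)) (U : 'M[E]_(q, s)) :
  (forall i j, of_deg t (A i j)) ->
  contract_mx (diff_mx A *m U) = ([A]E *m U) *+ t - diff_mx A *m contract_mx U.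
Proof.
move=> At; apply/matrixP => i j; rewrite !mxE raddf_sum /=.
rewrite mulmxnE in_alg_mulmxE -sumrMnl -sumrB; apply: eq_bigr => l _.
by rewrite !mxE /= (contract_diff _ (At i l)) mulr_natl scalerMnl.
Qed.

Lemma diff_mulmx p q s (A : 'M[S]_(p, q)) (B : 'M[S]_(q, s)) :
  diff_mx (A *m B) = diff_mx A *m [B]E + [A]E *m diff_mx B.
Proof.
apply/matrixP => i j; rewrite !mxE raddf_sum -big_split /=.
by apply: eq_bigr => l _; rewrite !mxE diffM mulr_algl mulr_algr.
Qed.

Variables (rk : nat -> nat) (d : forall i, 'M[S]_(rk i, rk i.+1)).
Local Notation dprod := (dprod diff d).
Hypothesis d_complex : forall i, d i *m d i.+1 = 0.
Variable deg : nat -> nat.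
Hypothesis d_homog : forall i a b, of_deg (deg i) (d i a b).

(** Contracting the first factor gives a multiple of d a times the rest.
Contracting a later one gives a term with diff (d a) * d a.+1, which is
- d a * diff (d a.+1) because d a *m d a.+1 = 0: all terms add up with the same
sign. *)
Lemma contract_dprod a b : (a < b)%N ->
  contract_mx (dprod a b) = ([d a]E *m dprod a.+1 b) *+ (\sum_(a <= i < b) deg i).
Proof.
move eqn: (b - a.+1)%N => n; elim: n a eqn => [|n IHn] a eqn ab.
  have -> : b = a.+1 by apply/eqP; rewrite eqn_leq ab -subn_eq0 eqn.
  rewrite dprodSl // !dprodnn (contract_diff_mx _ (@d_homog a)) big_nat1.
  rewrite (_ : contract_mx 1%:M = 0) ?mulmx0 ?subr0 //.
  by rewrite -(contract_in_alg0 1%:M) map_mx1.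
have ab' : (a.+1 < b)%N by rewrite -subn_gt0 eqn.
rewrite dprodSl // (contract_diff_mx _ (@d_homog a)) IHn //; last by rewrite subnS eqn.
rewrite (big_ltn ab) mulrnDr mulmxMnr mulmxA.
have -> : diff_mx (d a) *m [d a.+1]E = - ([d a]E *m diff_mx (d a.+1)).
  apply/eqP; rewrite -addr_eq0 -diff_mulmx d_complex.
  by apply/eqP/matrixP => i j; rewrite !mxE raddf0.
by rewrite mulNmx mulNrn opprK -mulmxA -dprodSl.
Qed.

Lemma contract_dprod_mul a b s (c : 'M[S]_(rk b, s)) : (a < b)%N ->
  contract_mx (dprod a b *m [c]E) =
    ([d a]E *m (dprod a.+1 b *m [c]E)) *+ (\sum_(a <= i < b) deg i).
Proof.
move=> ab; rewrite contract_mul_in_alg contract_dprod // mulmxA.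
by apply/matrixP => i j; rewrite mulmxnE !mxE -sumrMnl; apply: eq_bigr => l _;
  rewrite mulmxnE mulrnAl.
Qed.

Hypothesis contract_contract : forall u, contract (contract u) = 0.
Hypothesis d_ext_exact : forall i t (U : 'M[E]_(rk i.+1, t)),
  [d i]E *m U = 0 -> exists W, U = [d i.+1]E *m W.
Variables (V : zmodType) (aug : {additive E -> V}).
Hypothesis aug_contract : forall u, aug (contract u) = 0.
Hypothesis aug_min : forall i a b u, aug (d i a b *: u) = 0.
Hypothesis aug_char0 : forall c, (0 < c)%N -> aug (1 *+ c) != 0.
Hypothesis deg_gt0 : forall i, (0 < deg i)%N.

(** The product of all the differentials up to the end e of the complex is not zero,
even after an integral multiple and modulo the total boundaries of the tensor
product of the complex with the Koszul complex.  Contracting the relation for a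
and using exactness gives one for a.+1; for a = e it would write a nonzero
constant as a contraction plus an element of the maximal ideal. *)
Lemma dprod_not_null_homotopic e a c
    (U : 'M[E]_(rk a, rk e)) (W : 'M[E]_(rk a.+1, rk e)) :
  (0 < rk e)%N -> (a <= e)%N -> (0 < c)%N ->
  dprod a e *+ c <> contract_mx U + [d a]E *m W.
Proof.
move=> rk_gt0; move eqn: (e - a)%N => n.
elim: n a c eqn U W => [|n IHn] a c eqn U W ae c0 eqU.
  have ea : e = a by apply/eqP; rewrite eqn_leq -subn_eq0 eqn.
  subst a; pose o := Ordinal rk_gt0.
  have /eqP := congr1 (fun M : 'M[E]_(rk e) => aug (M o o)) eqU.
  rewrite dprodnn mulmxnE mxE eqxx [in X in _ == X]mxE raddfD /= mxE aug_contract.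
  rewrite add0r in_alg_mulmxE raddf_sum big1 => [|l _]; last exact: aug_min.
  by apply/negP/aug_char0.
have ae' : (a < e)%N by rewrite -subn_gt0 eqn.
have := congr1 (map_mx contract) eqU.
have -> : contract_mx (dprod a e *+ c) = contract_mx (dprod a e) *+ c.
  by apply/matrixP => i j; rewrite mxE !mulmxnE raddfMn mxE.
have -> : contract_mx (contract_mx U + [d a]E *m W) = [d a]E *m contract_mx W.
  rewrite map_mxD contract_in_alg -[RHS]add0r; congr (_ + _).
  by apply/matrixP => i j; rewrite !mxE; apply: contract_contract.
rewrite contract_dprod // -mulrnA -mulmxMnr => /eqP.
rewrite -subr_eq0 -mulmxBr => /eqP /d_ext_exact[W' /eqP]; rewrite subr_eq => /eqP.
rewrite addrC; apply: IHn => //; first by rewrite subnS eqn.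
by rewrite muln_gt0 c0 (big_ltn ae') addn_gt0 deg_gt0.
Qed.

End Matrices.

(** * Exactness for matrices of forms, and constant parts *)

Section Exactness.
Variables (k : fieldType) (r : nat).
Local Notation S := (polyS k r).
Local Notation E := (extalg S r.+1).
Local Notation "[ A ]E" := (map_mx (in_alg E) A) (format "[ A ]E").

Lemma exact_mx p q s t (A : 'M[S]_(p, q)) (B : 'M[S]_(q, s)) :
  (forall u : 'cV_q, A *m u = 0 -> exists w, u = B *m w) ->
  forall U : 'M_(q, t), A *m U = 0 -> exists W, U = B *m W.
Proof.
move=> exAB U AU0.
have /fin_all_exists[w wP] : forall j, exists w, col j U = B *m w.
  by move=> j; apply: exAB; rewrite colE mulmxA AU0 mul0mx.
exists (\matrix_(i, j) w j i 0); apply/matrixP => i j.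
have := congr1 (fun M : 'cV_q => M i 0) (wP j); rewrite !mxE => ->.
by apply: eq_bigr => l _; rewrite mxE.
Qed.

Definition ext_coef p q (U : 'M[E]_(p, q)) (T : {set 'I_r.+1}) : 'M[S]_(p, q) :=
  \matrix_(i, j) (U i j T).

Lemma ext_coefP p q (U W : 'M[E]_(p, q)) :
  (forall T, ext_coef U T = ext_coef W T) -> U = W.
Proof.
move=> UW; apply/matrixP => i j; apply/ffunP => T.
by have /matrixP/(_ i j) := UW T; rewrite !mxE.
Qed.

Lemma ext_coef_in_alg p q s (A : 'M[S]_(p, q)) (U : 'M[E]_(q, s)) T :
  ext_coef ([A]E *m U) T = A *m ext_coef U T.
Proof.
apply/matrixP => i j; rewrite !mxE ext_sumE; apply: eq_bigr => l _.
by rewrite !mxE mulr_algl extZE.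
Qed.

Lemma exact_ext p q s t (A : 'M[S]_(p, q)) (B : 'M[S]_(q, s)) :
  (forall u : 'cV_q, A *m u = 0 -> exists w, u = B *m w) ->
  forall U : 'M[E]_(q, t), [A]E *m U = 0 -> exists W : 'M[E]_(s, t), U = [B]E *m W.
Proof.
move=> exAB U AU0.
have /fin_all_exists[W WP] : forall T, exists W, ext_coef U T = B *m W.
  move=> T; apply: (exact_mx exAB); rewrite -ext_coef_in_alg AU0.
  by apply/matrixP => i j; rewrite !mxE ffunE.
pose W' : 'M[E]_(s, t) := \matrix_(i, j) ([ffun T => W T i j] : exterior S r.+1).
exists W'; apply: ext_coefP => T; rewrite ext_coef_in_alg WP; congr (_ *m _).
by apply/matrixP => i j; rewrite !mxE ffunE.
Qed.

(** A nonconstant term of g only contributes to degrees greater than t. *)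
Lemma mcoeff_homogM t (f g : S) m : f \is t.-homog -> mdeg m = t ->
  (f * g)@_m = f@_m * g@_0%MM.
Proof.
move=> ft mt; rewrite mcoeffM.
have m0 : (mdeg m < (mdeg m).+1)%N && (mdeg (0%MM : 'X_{1..r.+1}) < (mdeg m).+1)%N.
  by rewrite mdeg0 ltnSn.
case/andP: m0 => m1 m2.
rewrite (bigD1 (BMultinom m1, BMultinom m2)) /=; last by rewrite addm0.
rewrite big1 ?addr0 // => -[[k1 lt1] [k2 lt2]] /= /andP[/eqP mk nk].
have [k1t|k1t] := eqVneq (mdeg k1) t; last by rewrite (dhomog_nemf_coeff ft k1t) mul0r.
case/negP: nk; have k20 : k2 = 0%MM.
  apply/eqP; rewrite -mdeg_eq0; move: mt; rewrite mk mdegD k1t => /eqP.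
  by rewrite -[X in _ == X]addn0 eqn_add2l.
by rewrite xpair_eqE -!val_eqE /= mk k20 addm0 !eqxx.
Qed.

Definition const_coef p q (U : 'M[S]_(p, q)) : 'M[k]_(p, q) := map_mx (mcoeff 0%MM) U.
Local Notation "[ A ]S" := (map_mx (@mpolyC r.+1 k) A) (format "[ A ]S").

(** A solution of a linear system whose two sides have the same degree may be
replaced by its constant part: comparison maps become constant matrices. *)
Lemma mulmx_const_coef t p q s (A : 'M[S]_(p, q)) (U : 'M[S]_(q, s)) (V : 'M[S]_(p, s)) :
  (forall i j, A i j \is t.-homog) -> (forall i j, V i j \is t.-homog) ->
  A *m U = V -> A *m [const_coef U]S = V.
Proof.
move=> At Vt /matrixP AUV; apply/matrixP => i j; apply/mpolyP => m.
rewrite mxE raddf_sum /=; have [mt|mt] := eqVneq (mdeg m) t; last first.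
  rewrite (dhomog_nemf_coeff (Vt i j) mt) big1 // => l _.
  by rewrite !mxE mulrC mcoeffCM (dhomog_nemf_coeff (At i l) mt) mulr0.
rewrite -AUV mxE raddf_sum /=; apply: eq_bigr => l _.
by rewrite !mxE mulrC mcoeffCM (mcoeff_homogM _ (At i l) mt) mulrC.
Qed.

Lemma mulmx_const_homog t p q s (A : 'M[S]_(p, q)) (U : 'M[k]_(q, s)) i j :
  (forall i j, A i j \is t.-homog) -> (A *m [U]S) i j \is t.-homog.
Proof.
move=> At; rewrite mxE; apply: rpred_sum => l _.
by rewrite mxE mulrC mul_mpolyC; apply: rpredZ.
Qed.

End Exactness.

(** * Linear syzygies with constant coefficients *)

Section ConstantForms.
Variables (k : fieldType) (r : nat).
Local Notation S := (polyS k r).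
Local Notation E := (extalg S r.+1).
Local Notation Ek := (extalg k r.+1).
Local Notation "[ A ]E" := (map_mx (in_alg E) A) (format "[ A ]E").
Local Notation "[ A ]S" := (map_mx (@mpolyC r.+1 k) A) (format "[ A ]S").
Local Notation contract_mx := (map_mx (@contract k r)).
Local Notation const_mxE := (map_mx (@const_ext k r)).

Definition lin_ext (l : S) : Ek := linear_ext l.

Lemma lin_ext_is_additive : zmod_morphism lin_ext.
Proof.
move=> f g; apply/ffunP => A; rewrite extDE extNE !ffunE -sumrB.
by apply: eq_bigr => i _; case: eqP => _; rewrite ?mcoeffB ?subr0.
Qed.
HB.instance Definition _ := GRing.isZmodMorphism.Build S Ek lin_ext lin_ext_is_additive.

Lemma lin_ext_degree l : ext_degree 1 (lin_ext l).
Proof.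
move=> A A1; rewrite ffunE big1 // => i _; case: eqP => // Ai.
by rewrite Ai cards1 in A1.
Qed.

Lemma ext_degreeM (p q : nat) (u v : Ek) :
  ext_degree p u -> ext_degree q v -> ext_degree (p + q) (u * v).
Proof.
move=> up vq A Apq; rewrite extME big1 // => B BA.
have [Bp|Bp] := eqVneq #|B| p; last by rewrite up // mulr0 mul0r.
rewrite vq ?mulr0 // cardsD (setIidPr BA) Bp; apply: contraNneq Apq => <-.
by rewrite subnKC // -Bp subset_leq_card.
Qed.

Lemma ext_degree_sum (I : Type) (s : seq I) (F : I -> Ek) p :
  (forall i, ext_degree p (F i)) -> ext_degree p (\sum_(i <- s) F i).
Proof. by move=> Fp A Ap; rewrite ext_sumE big1 // => i _; apply: Fp. Qed.

Variables (rk : nat -> nat) (d : forall i, 'M[S]_(rk i, rk i.+1)).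
Local Notation lprod := (dprod lin_ext d).
Local Notation sprod := (dprod (@diff k r) d).

Lemma dprod_lin_degree a b i j : (a <= b)%N -> ext_degree (b - a) (lprod a b i j).
Proof.
elim: b j => [|b IHb] j.
  rewrite leqn0 => /eqP a0; subst a; rewrite dprodnn mxE => A A0.
  rewrite -scaler_nat extZE ffunE.
  by case: (A =P set0) A0 => [->|_ _]; rewrite ?cards0 // mulr0.
rewrite leq_eqVlt => /orP[/eqP ab|].
  subst a; rewrite dprodnn subnn mxE => A A0.
  rewrite -scaler_nat extZE ffunE.
  by case: (A =P set0) A0 => [->|_ _]; rewrite ?cards0 // mulr0.
rewrite ltnS => ab; rewrite dprodSr // subSn // mxE; apply: ext_degree_sum => l.
rewrite mxE -[(b - a).+1]addn1.
by apply: ext_degreeM; [apply: IHb | apply: lin_ext_degree].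
Qed.

(** Over a linear range the differentials of the entries have constant
coefficients, so the product lives over the base field. *)
Lemma const_dprod a b : (a <= b)%N ->
  (forall i, (a <= i < b)%N -> forall s t, d i s t \is 1.-homog) ->
  const_mxE (lprod a b) = sprod a b.
Proof.
move=> ab dlin; apply: map_dprod => // i abi s t.
by apply: const_linear_ext; apply: dlin.
Qed.

Lemma const_dprod_mul a b p (c : 'M[k]_(rk b, p)) : (a <= b)%N ->
  (forall i, (a <= i < b)%N -> forall s t, d i s t \is 1.-homog) ->
  const_mxE (lprod a b *m map_mx (in_alg Ek) c) = sprod a b *m [[c]S]E.
Proof.
move=> ab dlin; rewrite -(const_dprod ab dlin).
transitivity (const_mxE (lprod a b) *m const_mxE (map_mx (in_alg Ek) c)).
  exact: (map_mxM (@const_ext k r : {rmorphism Ek -> E})).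
congr (_ *m _); apply/matrixP => i j; rewrite !mxE; apply/ffunP => A.
by rewrite const_extE !extZE !ffunE mpolyCM mpolyC_nat.
Qed.

Hypothesis d_exact : forall i (u : 'cV_(rk i.+1)),
  d i *m u = 0 <-> exists w, u = d i.+1 *m w.
Variable deg : nat -> nat.
Hypothesis d_homog : forall i a b, d i a b \is (deg i).-homog.
Hypothesis k_char0 : forall n, n.+1%:R != 0 :> k.

Lemma exact_complex i : d i *m d i.+1 = 0.
Proof.
apply/matrixP => a b; rewrite [RHS]mxE.
have /matrixP/(_ a 0) : d i *m (d i.+1 *m delta_mx b 0) = 0 :> 'cV_(rk i).
  by apply/d_exact; exists (delta_mx b 0).
by rewrite mulmxA -colE !mxE.
Qed.

Lemma contract_diff_prod a b s (c : 'M[S]_(rk b, s)) : (a < b)%N ->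
  contract_mx (sprod a b *m [c]E) =
    ([d a]E *m (sprod a.+1 b *m [c]E)) *+ (\sum_(a <= i < b) deg i).
Proof.
apply: (contract_dprod_mul (@contract1 k r) (@diffM k r) (@contract_diff k r)).
  exact: exact_complex.
exact: d_homog.
Qed.

Definition coef_deg p q n (W : 'M[E]_(p, q)) : 'M[Ek]_(p, q) :=
  \matrix_(i, j) ([ffun A : {set 'I_r.+1} =>
     if #|A| == n then (W i j A : S)@_0%MM else 0] : exterior k r.+1).

Lemma contract_const_homog (u : Ek) A : contract (const_ext u) A \is 1.-homog.
Proof.
rewrite contractE; apply: rpred_sum => i _; rewrite const_extE mulrC mul_mpolyC.
apply: rpredZ; rewrite /wsign -signr_odd; case: odd; rewrite ?mulN1r ?mul1r ?rpredN.
  by rewrite dhomogX; apply/eqP; exact: mdeg1.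
by rewrite dhomogX; apply/eqP; exact: mdeg1.
Qed.

Lemma contract_const_degree n (u : Ek) (A : {set 'I_r.+1}) :
  ext_degree n.+1 u -> #|A| != n -> contract (const_ext u) A = 0.
Proof.
move=> un An; rewrite contractE big1 // => i iA.
by rewrite const_extE un ?mpolyC0 ?mulr0 // cardsU1 iA.
Qed.

(** By induction on the exterior degree of u.  The contraction of u lifts along the
complex to a constant form w of smaller degree, which by induction is a product
applied to a constant c; then contract_dprod shows that u and a multiple of the
longer product applied to c have the same contraction, and contract is injective
on constant forms of positive degree. *)
Lemma constant_syzygy_dprod n a b (u : 'cV[Ek]_(rk a.+1)) :
  (n + a.+1)%N = b ->
  (forall i, (a < i < b)%N -> deg i = 1%N) ->
  (forall i, ext_degree n (u i 0)) ->
  [d a]E *m contract_mx (const_mxE u) = 0 ->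
  exists c : 'cV[k]_(rk b), u = lprod a.+1 b *m map_mx (in_alg Ek) c.
Proof.
elim: n a u => [|n IHn] a u; rewrite ?add0n.
  move=> ab; subst b => _ un _.
  exists (map_mx (fun x : Ek => x set0) u); rewrite dprodnn mul1mx.
  apply/matrixP => i j; rewrite !mxE ord1; apply/ffunP => A; rewrite extZE ffunE.
  by case: (A =P set0) => [->|/eqP A0]; rewrite ?mulr1 // mulr0 un // cards_eq0.
move=> nab deg1 un du0.
have ab : (a.+1 < b)%N by rewrite -nab addSn ltnS leq_addl.
have da1 : deg a.+1 = 1%N by apply: deg1; rewrite ltnSn.
have [W cuW] := exact_ext (fun v => proj1 (@d_exact a v)) du0.
pose w := coef_deg n W.
(* Both sides are linear in the variables, so W may be cut to its constant part. *)
have cuw : contract_mx (const_mxE u) = [d a.+1]E *m const_mxE w.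
  apply: ext_coefP => A; rewrite ext_coef_in_alg.
  have [An|An] := eqVneq #|A| n; last first.
    rewrite (_ : ext_coef _ A = 0) => [|]; last first.
      by apply/matrixP => i j; rewrite !mxE (contract_const_degree _ An) // ord1.
    rewrite (_ : ext_coef (const_mxE w) A = 0) ?mulmx0 //.
    by apply/matrixP => i j; rewrite !mxE const_extE ffunE (negPf An) mpolyC0.
  have -> : ext_coef (const_mxE w) A = [const_coef (ext_coef W A)]S.
    by apply/matrixP => i j; rewrite !mxE const_extE ffunE An eqxx.
  apply/esym/(@mulmx_const_coef _ _ 1) => [i j|i j|].
  - by rewrite -da1.
  - by rewrite !mxE; apply: contract_const_homog.
  - by rewrite -ext_coef_in_alg -cuW.
have [||||c wc] := IHn a.+1 w.
- by rewrite addnS -addSn.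
- by move=> i /andP[ai ib]; apply: deg1; rewrite (ltnW ai).
- by move=> i A An; rewrite mxE ffunE (negPf An).
- rewrite -contract_in_alg -cuw; apply/matrixP => i j; rewrite !mxE; exact: contract_contract.
pose v := lprod a.+1 b *m map_mx (in_alg Ek) c.
have sumdeg : (\sum_(a.+1 <= i < b) deg i = n.+1)%N.
  rewrite (eq_big_nat _ _ (F2 := fun=> 1%N)) => [|i /andP[ai ib]]; last first.
    by apply: deg1; rewrite ai.
  by rewrite sum_nat_const_nat muln1 -nab addnK.
have lin_from j : (a < j)%N -> forall i, (j <= i < b)%N -> forall s t, d i s t \is 1.-homog.
  by move=> aj i /andP[ji ib] s t; rewrite -(deg1 i) ?(leq_trans aj).
have cvE := const_dprod_mul c (ltnW ab) (lin_from _ (ltnSn a)).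
have cwE := const_dprod_mul c ab (lin_from _ (leqnSn _)).
rewrite -wc in cwE; rewrite -/v in cvE.
have cvw : contract_mx (const_mxE v) = contract_mx (const_mxE u) *+ n.+1.
  by rewrite cuw cwE cvE -sumdeg; apply: contract_diff_prod.
have uv i : u i 0 *+ n.+1 = v i 0.
  apply/eqP; rewrite -subr_eq0; apply/eqP/contract_const_inj.
    rewrite extDE extNE -scaler_nat extZE un ?cards0 // mulr0 sub0r.
    rewrite /v mulmx_in_algE ext_sumE big1 ?oppr0 // => l _.
    rewrite extZE (dprod_lin_degree _ _ (ltnW ab)) ?mulr0 //.
    by rewrite cards0 -nab addnK.
  rewrite raddfB raddfMn /= raddfB raddfMn /=.
  have := congr1 (fun M : 'cV[E]__ => M i 0) cvw.
  by rewrite mulmxnE !mxE => <-; rewrite subrr.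
exists (n.+1%:R^-1 *: c); apply/matrixP => i j; rewrite ord1.
have := congr1 (fun x => n.+1%:R^-1 *: x) (uv i).
rewrite -scaler_nat scalerA mulVf ?k_char0 // scale1r => ->.
rewrite !mulmx_in_algE scaler_sumr; apply: eq_bigr => l _.
by rewrite mxE scalerA.
Qed.

End ConstantForms.

(** * Vanishing of the lower cohomology of the dual complex *)

Section Coexactness.
Variable (S : comNzRingType).
Variables (rk : nat -> nat) (d : forall i, 'M[S]_(rk i, rk i.+1)).

(** The row vectors in z are coboundaries of the dual complex. *)
Definition factors i m : 'M[S]_(m, rk i) -> Prop :=
  match i with
  | 0 => fun z => z = 0
  | i'.+1 => fun z => exists v, z = v *m d i'
  end.

Definition coexact i := forall m (z : 'M[S]_(m, rk i)), z *m d i = 0 -> factors z.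

Lemma factors0 i m : factors (0 : 'M_(m, rk i)).
Proof. by case: i => [//|i]; exists 0; rewrite mul0mx. Qed.

Lemma factorsD i m (z1 z2 : 'M_(m, rk i)) :
  factors z1 -> factors z2 -> factors (z1 + z2).
Proof.
case: i z1 z2 => [|i] z1 z2 /=; first by move=> -> ->; rewrite addr0.
by move=> [v1 ->] [v2 ->]; exists (v1 + v2); rewrite mulmxDl.
Qed.

Lemma factors_sum (I : finType) i m (F : I -> 'M_(m, rk i)) :
  (forall j, factors (F j)) -> factors (\sum_j F j).
Proof. by move=> Ff; elim/big_ind: _ => //; [apply: factors0 | apply: factorsD]. Qed.

Lemma factorsM i m n (A : 'M_(n, m)) (z : 'M_(m, rk i)) : factors z -> factors (A *m z).
Proof.
case: i z => [|i] z /=; first by move=> ->; rewrite mulmx0.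
by move=> [v ->]; exists (A *m v); rewrite mulmxA.
Qed.

Hypothesis d_complex : forall i, d i *m d i.+1 = 0.
Hypothesis d_exact : forall i m (u : 'M_(rk i.+1, m)),
  d i *m u = 0 -> exists w, u = d i.+1 *m w.

Lemma factors_mulmx i m (z : 'M_(m, rk i)) : factors z -> z *m d i = 0.
Proof.
case: i z => [|i] z /=; first by move=> ->; rewrite mul0mx.
by move=> [v ->]; rewrite -mulmxA d_complex mulmx0.
Qed.

(** For x in the ideal generated by d 0, multiplication by x is homotopic to zero.
The equation is what the relation d h' + h d = x gives after multiplication by d
on the left, a form that is uniform in i. *)
Lemma mult_null_homotopic (x : S) i (h0 : 'M_(rk 1, rk 0)) : x%:M = d 0 *m h0 ->
  exists h, d i *m h *m d i = x *: d i.
Proof.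
move=> xh; elim: i => [|i [h dhd]]; first by exists h0; rewrite -xh mul_scalar_mx.
have /d_exact[h' h'P] : d i *m (x%:M - h *m d i) = 0.
  by rewrite mulmxBr mulmxA dhd mul_mx_scalar subrr.
exists h'; rewrite -h'P mulmxBl -mulmxA d_complex mulmx0 subr0.
by rewrite mul_scalar_mx.
Qed.

(** The ideal generated by d 0 annihilates the cohomology of the dual complex. *)
Lemma mult_factors (x : S) i (h0 : 'M_(rk 1, rk 0)) m (z : 'M_(m, rk i)) :
  x%:M = d 0 *m h0 -> z *m d i = 0 -> factors (x *: z).
Proof.
case: i z => [|i] z xh zd /=.
  by rewrite -mul_mx_scalar xh mulmxA zd mul0mx.
have [h dhd] := mult_null_homotopic i xh.
have /d_exact[h' h'P] : d i *m (x%:M - h *m d i) = 0.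
  by rewrite mulmxBr mulmxA dhd mul_mx_scalar subrr.
exists (z *m h); apply/eqP; rewrite -mulmxA -mul_mx_scalar -subr_eq0 -mulmxBr h'P.
by rewrite mulmxA zd mul0mx.
Qed.

(** By coexactness d p *m A extends downwards to a chain map from the part of F below
index q to the part below index p.  As q <= p, the source ends while the target
is still exact, so the chain map is null-homotopic; the homotopy is built
upwards from there. *)
Lemma null_homotopic_lift q p (A : 'M_(rk p.+1, rk q)) :
  (forall i, (i <= q)%N -> coexact i) -> (q <= p)%N ->
  d p *m A *m d q = 0 -> exists w, factors (A - d p.+1 *m w).
Proof.
elim: q p A => [|q IHq] p A coex qp /(coex _ (leqnn _)) /=.
  by move=> /d_exact[w ->]; exists w; rewrite subrr.
case: p qp A => // p qp A [B dA].
have [||w /factors_mulmx/eqP] := IHq p B _ qp.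
- by move=> i iq; apply/coex/leqW.
- by rewrite -mulmxA -dA mulmxA d_complex mul0mx.
rewrite mulmxBl -dA subr_eq0 => /eqP dAw.
have /d_exact[w' w'P] : d p.+1 *m (A - w *m d q) = 0.
  by rewrite mulmxBr dAw mulmxA subrr.
by exists w', w; rewrite -w'P opprB addrC subrK.
Qed.

Variable e : nat.
Hypothesis rk_top : (0 < rk e.+1)%N.
Hypothesis d_top_inj : forall m (u : 'M_(rk e.+1, m)), d e *m u = 0 -> u = 0.
Hypothesis d_top_ideal : forall a b, exists h0, (d e a b)%:M = d 0 *m h0.

(** For a cocycle z with values in the last module, d e *m z is a coboundary because
the entries of d e lie in the ideal generated by d 0.  Up to cocycles a primitive
of it is a multiple of d e by [null_homotopic_lift], and d e can be cancelled. *)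
Lemma coexact_le i : (i <= e)%N -> coexact i.
Proof.
elim/ltn_ind: i => i IHi ie.
have coexZ (Z : 'M_(rk e.+1, rk i)) : Z *m d i = 0 -> factors Z.
  move=> Zd; have dZ : factors (d e *m Z).
    rewrite [d e]matrix_sum_delta mulmx_suml; apply: factors_sum => a.
    rewrite mulmx_suml; apply: factors_sum => b; have [h0 h0P] := d_top_ideal a b.
    rewrite -scalemxAl; apply: mult_factors h0P _.
    by rewrite -mulmxA Zd mulmx0.
  case: i IHi ie Z Zd dZ => [|i] IHi ie Z Zd /=; first exact: d_top_inj.
  move=> [B dZ]; case: e IHi ie d_top_inj Z Zd B dZ => // p IHi ip d_inj Z Zd B dZ.
  have [||w /factors_mulmx/eqP] := @null_homotopic_lift i p B _ ip.
  - by move=> j ji; apply: IHi => //; apply: leq_trans ji (ltnW ip).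
  - by rewrite -mulmxA -dZ mulmxA d_complex mul0mx.
  rewrite mulmxBl -dZ subr_eq0 => /eqP dZw; exists w.
  apply/eqP; rewrite -subr_eq0; apply/eqP/d_inj.
  by rewrite mulmxBr dZw mulmxA subrr.
move=> m z zd; pose o := Ordinal rk_top.
(* Reduction to rows, each placed in one coordinate of the last module. *)
have -> : z = \sum_(j < m) delta_mx j o *m (delta_mx o j *m z).
  under eq_bigr => j _ do rewrite mulmxA mul_delta_mx.
  rewrite -mulmx_suml -[LHS]mul1mx; congr (_ *m _).
  by rewrite -diag_const_mx diag_mx_sum_delta; apply: eq_bigr => j _; rewrite mxE scale1r.
apply: factors_sum => j; apply/factorsM/coexZ.
by rewrite -mulmxA zd mulmx0.
Qed.

End Coexactness.

(** * The end of a Gorenstein resolution *)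

Section Zhomog.
Variables (k : fieldType) (r : nat).
Local Notation S := (polyS k r).
Implicit Types (f g : S) (m : int).

Lemma zhomog0 m : zhomog m (0 : S).
Proof. by case: m => [j|j] //=; apply: dhomog0. Qed.

Lemma zhomogB m f g : zhomog m f -> zhomog m g -> zhomog m (f - g).
Proof.
case: m => [j|j] /=; last by move=> -> ->; rewrite subr0.
exact: rpredB.
Qed.

Lemma zhomogM (j : nat) m f g : f \is j.-homog -> zhomog m g -> zhomog (m + j%:Z) (f * g).
Proof.
case: m => [i|i] /= fj; last by move=> ->; rewrite mulr0; apply: zhomog0.
by move=> gi; rewrite addnC; apply: dhomogM.
Qed.

Lemma zhomogC m (c : k) : m = 0 -> zhomog m (c%:MP : S).
Proof. by move=> ->; rewrite -[c%:MP]mulr1 mul_mpolyC; apply: rpredZ; apply: dhomog1. Qed.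

Lemma homog0_const f : f \is 0.-homog -> f = (f@_0%MM)%:MP.
Proof.
move=> f0; apply/mpolyP => m; rewrite mcoeffC.
have [->|m0] := eqVneq m 0%MM; first by rewrite mulr1.
by rewrite mulr0 (dhomog_nemf_coeff f0) //= mdeg_eq0.
Qed.

End Zhomog.

(** Here the last module of the resolution is F_(e+1). *)
Section GorensteinTop.
Variables (k : fieldType) (r : nat) (I : polyS k r -> Prop) (F : gfree_complex k r).
Local Notation S := (polyS k r).
Variables (n e : nat).
Local Notation rk := (fc_rk F).
Local Notation d := (fc_d F).
Hypothesis ID : forall f g, I f -> I g -> I (f + g).
Hypothesis IM : forall f g, I g -> I (f * g).
Hypothesis Ihomog : forall j f, I f -> I (pihomog mdeg j f).
Hypothesis d_min : forall i a b, (d i a b)@_0%MM = 0.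
Hypothesis d_zhomog : forall i a b,
  zhomog (@fc_sh k r F i.+1 b - @fc_sh k r F i a) (d i a b).
Hypothesis F_length : resolution_length F e.+1.
Hypothesis r_eq : r = (n + e.+1)%N.
Hypothesis Ext_iso :
  gmod_iso (Ext_module F e.+1 (- r.+1%:Z)) (coord_module I (1 - n%:Z)).

Lemma idealB f g : I f -> I g -> I (f - g).
Proof. by move=> If Ig; apply: ID If _; rewrite -mulN1r; apply: IM. Qed.

Lemma ideal_eqmod f g : I (f - g) -> I f <-> I g.
Proof.
move=> Ifg; split=> [If|Ig]; last by rewrite -[f](subrK g); apply: ID.
by rewrite -[g](subKr f); apply: idealB.
Qed.

Lemma coboundary_const (u : 'rV[S]_(rk e.+1)) : coboundary (F := F) (i := e.+1) u ->
  forall b, (u 0 b)@_0%MM = 0.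
Proof.
move=> [w ->] b; rewrite mxE raddf_sum big1 // => l _.
by rewrite /= rmorphM /= d_min mulr0.
Qed.

Definition row_zhomog m (u : 'rV[S]_(rk e.+1)) :=
  forall b, zhomog (m + fc_sh b - r.+1%:Z) (u 0 b).

(** Since F stops at index e+1, every row vector is a cocycle there. *)
Lemma Ext_iso_rows : exists phi : int -> 'rV[S]_(rk e.+1) -> S,
  [/\ forall m u, row_zhomog m u -> zhomog (m + (1 - n%:Z)) (phi m u),
      forall m u v, row_zhomog m u -> row_zhomog m v ->
        I (phi m (u + v) - phi m u - phi m v),
      forall m (j : nat) (s : S) u, s \is j.-homog -> row_zhomog m u ->
        I (phi (m + j%:Z) (s *: u) - s * phi m u),
      forall m u, row_zhomog m u ->
        (I (phi m u) <-> coboundary (F := F) (i := e.+1) u)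
    & forall m f, zhomog (m + (1 - n%:Z)) f ->
        exists2 u, row_zhomog m u & I (phi m u - f)].
Proof.
have [_ rk0] := F_length; have [phi [P1 P2 P3 P4 P5]] := Ext_iso.
have cyc_d (u : 'rV[S]_(rk e.+1)) : u *m d e.+1 = 0.
  by apply/matrixP => i j; case: j => j jlt; exfalso; move: jlt; rewrite rk0.
exists phi; split.
- by move=> m u uh; exact: (P1 m Logic.I u (conj uh (cyc_d u))).
- move=> m u v uh vh.
  exact: (P2 m Logic.I u v (conj uh (cyc_d u)) (conj vh (cyc_d v))).
- move=> m j s u sj uh.
  exact: (P3 m j Logic.I Logic.I s u sj (conj uh (cyc_d u))).
- by move=> m u uh; exact: (P4 m Logic.I u (conj uh (cyc_d u))).
- by move=> m f fh; have [u [uh _] uf] := P5 m Logic.I f fh; exists u.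
Qed.

Lemma row_zhomogZ m (j : nat) (f : S) u : f \is j.-homog ->
  row_zhomog m u -> row_zhomog (m + j%:Z) (f *: u).
Proof.
move=> fj uh b; rewrite mxE.
rewrite (_ : _ - _ = (m + fc_sh b - r.+1%:Z) + j%:Z); last by lia.
exact: zhomogM.
Qed.

Lemma row_zhomogB m u v : row_zhomog m u -> row_zhomog m v -> row_zhomog m (u - v).
Proof.
move=> uh vh b.
have -> : (u - v) 0 b = u 0 b - v 0 b by rewrite !mxE.
exact: zhomogB.
Qed.

(** Let x be a class that corresponds to 1.  Every basis vector is congruent to f x
modulo coboundaries, where f corresponds to it, and coboundaries have no constant
terms by minimality; so there is only one basis vector and x is a scalar multiple
of it.  The isomorphism then identifies the coboundaries with the ideal. *)
Lemma gorenstein_top :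
  [/\ rk e.+1 = 1%N, forall b : 'I_(rk e.+1), fc_sh b = (e.+1 + 2)%:Z,
      forall a b, I (d e a b)
    & forall f, I f -> exists w : 'rV_(rk e), forall b, (w *m d e) 0 b = f].
Proof.
have [rk_gt0 _] := F_length; have [phi [P1 P2 P3 P4 P5]] := Ext_iso_rows.
pose m0 : int := n%:Z - 1.
have [|x xh xP] := P5 m0 1.
  by rewrite /m0 addrA subrK subrr; apply: dhomog1.
have phix f : I (f * phi m0 x - f).
  by rewrite -[X in _ - X]mulr1 -mulrBr; apply: IM.
(* In negative degree f would be 0 and the basis vector itself a coboundary. *)
have lift b : exists j f, [/\ f \is j.-homog, r.+1%:Z - fc_sh b = m0 + j%:Z
     & coboundary (F := F) (i := e.+1) (delta_mx 0 b - f *: x)].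
  pose mb := r.+1%:Z - fc_sh b.
  have ebh : row_zhomog mb (delta_mx 0 b).
    move=> b'; rewrite mxE eqxx /=; case: eqP => [->|_]; last exact: zhomog0.
    by rewrite /mb subrK subrr; apply: dhomog1.
  have := P1 mb _ ebh; set f : S := phi mb _ => fh.
  move: fh; case Em: (mb + _) => [j|j] /= fj.
    have mbE : mb = m0 + j%:Z by rewrite /m0; lia.
    exists j, f; split=> //.
    have fxh : row_zhomog mb (f *: x) by rewrite mbE; apply: row_zhomogZ.
    have ebfxh := row_zhomogB ebh fxh.
    apply/(P4 mb _ ebfxh).
    have := P2 mb _ _ ebfxh fxh; rewrite subrK -/f => I1.
    have := P3 m0 j f x fj xh; rewrite -mbE => I2.
    have := ID (ID I1 I2) (phix f).
    rewrite (_ : _ + _ = - phi mb (delta_mx 0 b - f *: x)); last by ring.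
    by move=> /(IM (-1)); rewrite mulN1r opprK.
  have /(P4 mb _ ebh)/coboundary_const/(_ b) : I (phi mb (delta_mx 0 b)).
    by rewrite -/f fj -[0](mul0r (phi m0 x - 1)); apply: IM.
  by rewrite mxE !eqxx mcoeff1 eqxx => /eqP; rewrite oner_eq0.
have lift0 b : exists f : S, [/\ r.+1%:Z - fc_sh b = m0, f@_0%MM * (x 0 b)@_0%MM = 1
     & forall b', b' != b -> f@_0%MM * (x 0 b')@_0%MM = 0].
  have [j [f [fj mb /coboundary_const cob]]] := lift b.
  have fx b' : f@_0%MM * (x 0 b')@_0%MM = (b' == b)%:R.
    have /eqP := cob b'; rewrite !mxE eqxx mcoeffB rmorphM /= subr_eq0 => /eqP <-.
    by rewrite -mpolyC_nat mcoeffC eqxx mulr1.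
  exists f; split; first 1 last; first by rewrite fx eqxx.
    by move=> b' /negPf b'b; rewrite fx b'b.
  rewrite mb; have [->|j0] := eqVneq j 0%N; first by rewrite addr0.
  have f0 : f@_0%MM = 0 by apply: (dhomog_nemf_coeff fj); rewrite /= mdeg0 eq_sym.
  by have /eqP := fx b; rewrite f0 mul0r eqxx eq_sym oner_eq0.
have rk1 (b b' : 'I_(rk e.+1)) : b = b'.
  apply/eqP/negPn/negP => bb'; have [f [_ fb fb']] := lift0 b.
  have [f' [_ f'b' _]] := lift0 b'.
  have b'b : b' != b by rewrite eq_sym.
  have /eqP := fb' b' b'b; rewrite mulf_eq0 => /orP[]/eqP z0.
    by move/eqP: fb; rewrite z0 mul0r eq_sym oner_eq0.
  by move/eqP: f'b'; rewrite z0 mulr0 eq_sym oner_eq0.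
have rkE : rk e.+1 = 1%N.
  apply/eqP; rewrite eqn_leq rk_gt0 andbT leqNgt; apply/negP => rk2.
  by have := rk1 (Ordinal rk2) (Ordinal rk_gt0).
have shE (b : 'I_(rk e.+1)) : fc_sh b = (e.+1 + 2)%:Z.
  by have [f [+ _ _]] := lift0 b; rewrite /m0; move: r_eq; lia.
pose o := Ordinal rk_gt0.
have [c c0 xE] : exists2 c : k, c != 0 & x = c%:MP *: delta_mx 0 o.
  exists (x 0 o)@_0%MM.
    have [f [_ + _]] := lift0 o; apply: contra_eqN => /eqP ->.
    by rewrite mulr0 eq_sym oner_neq0.
  have [f [mb _ _]] := lift0 o.
  have := xh o; rewrite (_ : _ - _ = 0%:Z); last by move: mb; rewrite /m0; lia.
  rewrite /= => xo; apply/matrixP => i j; rewrite ord1 !mxE (rk1 j o) eqxx /= mulr1.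
  exact: homog0_const.
have Ihom j g : g \is j.-homog ->
    I g <-> coboundary (F := F) (i := e.+1) (g *: x).
  move=> gj; have gxh := row_zhomogZ gj xh.
  rewrite -(P4 _ _ gxh); split=> [Ig|Igx].
    apply/(ideal_eqmod (g := g * phi m0 x)); first exact: P3.
    by rewrite mulrC; apply: IM.
  apply/(ideal_eqmod (f := g * phi m0 x)); first exact: phix.
  by apply/(ideal_eqmod (f := phi (m0 + j%:Z) (g *: x))); first exact: P3.
have IhomE j g : g \is j.-homog -> I g <-> exists w : 'rV_(rk e), g *: delta_mx 0 o = w *m d e.
  move=> gj; rewrite (Ihom j) // xE; split=> -[w wP].
    exists (c^-1%:MP *: w); rewrite -scalemxAl -wP !scalerA; congr (_ *: _).
    by rewrite mulrAC -mpolyCM mulVf // mul1r.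
  by exists (c%:MP *: w); rewrite -scalemxAl -wP !scalerA mulrC.
split=> // [a b|f If].
  have := d_zhomog a b; case: (_ - _) => j /= dj; last first.
    by rewrite dj -[0](mul0r (phi m0 x - 1)); apply: IM.
  apply/(IhomE j) => //; exists (delta_mx 0 a); rewrite -rowE.
  by apply/matrixP => i l; rewrite ord1 !mxE (rk1 l o) (rk1 b o) eqxx mulr1.
have [w wP] : exists w : 'rV_(rk e), f *: delta_mx 0 o = w *m d e.
  rewrite [f](pihomog_partitionE (mf := mdeg) (leqnn _)).
  rewrite scaler_suml; elim/big_ind: _ => [|u v [w1 ->] [w2 ->]|j _].
  - by exists 0; rewrite mul0mx.
  - by exists (w1 + w2); rewrite mulmxDl.
  - by apply/(IhomE j); [apply: pihomogP | apply: Ihomog].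
exists w => b; rewrite -wP !mxE (rk1 b o) eqxx.
by rewrite mulr1.
Qed.

End GorensteinTop.

(** * Reversing products of 1-forms *)

Section Reversal.
Variables (S : comNzRingType) (E : algType S) (diff : {additive S -> E}).
Local Notation "[ A ]E" := (map_mx (in_alg E) A) (format "[ A ]E").
Local Notation diff_mx := (map_mx diff).
Hypothesis diffM : forall f g, diff (f * g) = g *: diff f + f *: diff g.
Hypothesis diff_anticomm : forall f g, diff f * diff g = - (diff g * diff f).

(** The behaviour of a form of degree s with respect to 1-forms. *)
Definition sign_commutes (s : nat) (x : E) :=
  forall f, x * diff f = (-1) ^+ s * (diff f * x).

Lemma sign_commutes_sum s (I : Type) (t : seq I) (F : I -> E) :
  (forall i, sign_commutes s (F i)) -> sign_commutes s (\sum_(i <- t) F i).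
Proof.
by move=> Fs f; rewrite mulr_suml !mulr_sumr; apply: eq_bigr => i _; apply: Fs.
Qed.

Lemma sign_commutesZ s (a : S) x : sign_commutes s x -> sign_commutes s (a *: x).
Proof. by move=> xs f; rewrite -scalerAl xs -!scalerAr. Qed.

Lemma sign_commutes_mul_diff s x g : sign_commutes s x -> sign_commutes s.+1 (x * diff g).
Proof.
move=> xs f.
have -> : x * diff g * diff f = - (x * diff f * diff g).
  by rewrite -!mulrA (diff_anticomm g) mulrN.
by rewrite xs exprS mulN1r mulNr -!mulrA.
Qed.

Variables (rk : nat -> nat) (d : forall i, 'M[S]_(rk i, rk i.+1)).
Local Notation dprod := (dprod diff d).

Lemma dprod_sign_commutes a b i j : (a <= b)%N -> sign_commutes (b - a) (dprod a b i j).
Proof.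
have comm1 c l h : sign_commutes (c - c) (dprod c c l h).
  by move=> f; rewrite dprodnn mxE subnn mul1r mulr_natl mulr_natr.
elim: b j => [|b IHb] j; first by rewrite leqn0 => /eqP a0; subst a.
rewrite leq_eqVlt => /orP[/eqP ab|]; first by subst a.
rewrite ltnS => ab; rewrite dprodSr // subSn // mxE; apply: sign_commutes_sum => l.
by rewrite mxE; apply/sign_commutes_mul_diff/IHb.
Qed.

Lemma trmx_mul_diff s p q m (X : 'M[E]_(q, m)) (A : 'M[S]_(p, q)) :
  (forall i j, sign_commutes s (X i j)) ->
  X^T *m (diff_mx A)^T = (-1) ^+ s *: (diff_mx A *m X)^T.
Proof.
move=> Xs; apply/matrixP => i j; rewrite !mxE mulr_sumr; apply: eq_bigr => l _.
by rewrite !mxE Xs.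
Qed.

Lemma trmx_mul_in_alg p q m (X : 'M[E]_(p, q)) (A : 'M[S]_(q, m)) :
  (X *m [A]E)^T = [A^T]E *m X^T.
Proof.
apply/matrixP => i j; rewrite !mxE; apply: eq_bigr => l _; rewrite !mxE.
by rewrite mulr_algl mulr_algr.
Qed.

Variables (e : nat) (phi : forall i j, 'M[S]_(rk i, rk j)).
Hypothesis diff_phi : forall i j, diff_mx (phi i j) = 0.
Hypothesis phi_chain : forall i j, (i + j)%N = e ->
  d i *m phi i.+1 j = phi i j.+1 *m (d j)^T.

Lemma diff_phi_chain i j : (i + j)%N = e ->
  diff_mx (d i) *m [phi i.+1 j]E = [phi i j.+1]E *m (diff_mx (d j))^T.
Proof.
move=> ije; have := congr1 (map_mx diff) (phi_chain ije).
by rewrite !diff_mulmx // !diff_phi mulmx0 mul0mx addr0 add0r map_trmx.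
Qed.

(** phi is a chain map from the dual complex to the complex; each step moves it past
one factor, which becomes the transpose of the opposite differential and has to
be moved past the factors already transposed. *)
Lemma dprod_reversal a b c a' : (a <= b)%N -> (b + c)%N = e.+1 -> (a + a')%N = e.+1 ->
  exists s, dprod a b *m [phi b c]E = (-1) ^+ s *: ([phi a a']E *m (dprod c a')^T).
Proof.
move=> ab bc aa'; elim: b c ab bc => [|b IHb] c.
  rewrite leqn0 => /eqP a0; subst a; rewrite add0n => ce; subst c.
  move: aa'; rewrite add0n => ea'; subst a'; exists 0%N.
  by rewrite !dprodnn trmx1 mul1mx mulmx1 scale1r.
rewrite leq_eqVlt => /orP[/eqP ab bc|].
  have ca' : c = a' by apply/eqP; rewrite -(eqn_add2l a) aa' ab bc.
  subst a a'; exists 0%N.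
  by rewrite !dprodnn trmx1 mul1mx mulmx1 scale1r.
rewrite ltnS => ab bc; have bce : (b + c)%N = e by move: bc; rewrite addSn => -[].
have [|s IH] := IHb c.+1 ab; first by rewrite addnS bce.
have ca' : (c < a')%N by rewrite -(ltn_add2l b) bce -ltnS -aa' ltnS leq_add2r.
exists (s + (a' - c.+1))%N; rewrite dprodSr // -mulmxA diff_phi_chain //.
rewrite mulmxA IH -scalemxAl -mulmxA.
rewrite (trmx_mul_diff _ (fun i j => dprod_sign_commutes i j ca')) -dprodSl //.
rewrite exprD -scalerA; congr (_ *: _); apply/matrixP => i j.
rewrite !mxE mulr_sumr; apply: eq_bigr => l _; rewrite !mxE.
by rewrite [LHS]mulrA commr_sign -mulrA.
Qed.

(** Exchanging the two outer 1-forms changes the sign and transposes X. *)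
Lemma quadratic_form_alternates s p q (A : 'M[S]_(p, q)) (X : 'M[E]_q) i :
  (forall l h, sign_commutes s (X l h)) -> X^T = X ->
  let w := (diff_mx A *m X *m (diff_mx A)^T) i i in w = - w.
Proof.
move=> Xs XT /=.
have wE : (diff_mx A *m X *m (diff_mx A)^T) i i =
    \sum_h \sum_l diff (A i l) * X l h * diff (A i h).
  rewrite mxE; apply: eq_bigr => h _; rewrite !mxE mulr_suml.
  by apply: eq_bigr => l _; rewrite !mxE.
rewrite wE {1}exchange_big /= -sumrN; apply: eq_bigr => l _; rewrite -sumrN.
apply: eq_bigr => h _.
have XE : X h l = X l h by rewrite -{1}XT mxE.
have move_x f g : diff f * X l h * diff g = (-1) ^+ s * (diff f * diff g * X l h).
  by rewrite -mulrA Xs mulrA commr_sign -!mulrA.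
by rewrite XE !move_x (diff_anticomm (A i l)) mulNr mulrN.
Qed.

End Reversal.

(** * The degrees in a Gorenstein resolution *)

(** In this section the last module of the resolution is F_(e+1), and d e is its last
matrix. *)

Section GorensteinResolution.
Variables (k : fieldType) (r : nat) (I : polyS k r -> Prop) (F : gfree_complex k r).
Local Notation S := (polyS k r).
Local Notation "[ A ]S" := (map_mx (@mpolyC r.+1 k) A) (format "[ A ]S").
Variables (n e : nat).
Local Notation rk := (fc_rk F).
Local Notation d := (fc_d F).
Local Notation sh := (fc_sh (g := F)).
Hypothesis k_char0 : forall m, m.+1%:R != 0 :> k.
Hypothesis F_res : minimal_free_resolution I F.
Hypothesis Ihomog : forall j f, I f -> I (pihomog mdeg j f).
Hypothesis I_nondegenerate : forall l, l \is 1.-homog -> I l -> l = 0.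
Hypothesis F_length : resolution_length F e.+1.
Hypothesis r_eq : r = (n + e.+1)%N.
Hypothesis Ext_iso :
  gmod_iso (Ext_module F e.+1 (- r.+1%:Z)) (coord_module I (1 - n%:Z)).
Hypothesis e_gt1 : (1 < e)%N.

Lemma rk0_1 : rk 0 = 1%N. Proof. by have [[]] := F_res. Qed.

Lemma d_zhomog i a b : zhomog (@fc_sh k r F i.+1 b - @fc_sh k r F i a) (d i a b).
Proof. by have [_ H _ _ _] := F_res; apply: H. Qed.

Lemma d_min i a b : (d i a b)@_0%MM = 0.
Proof. by have [_ _ _ _ H] := F_res; apply: H. Qed.

Lemma d_exact i (u : 'cV_(rk i.+1)) : d i *m u = 0 <-> exists w, u = d i.+1 *m w.
Proof. by have [_ _ _ H _] := F_res; apply: H. Qed.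

Lemma d_exact_mx i m (u : 'M_(rk i.+1, m)) : d i *m u = 0 -> exists w, u = d i.+1 *m w.
Proof. by apply: exact_mx => v /d_exact. Qed.

Lemma d_complex i : d i *m d i.+1 = 0.
Proof. by apply: exact_complex => j u; apply: d_exact. Qed.

Lemma rk0_eq (a b : 'I_(rk 0)) : a = b.
Proof. by apply/ord_inj; case: a b => [a a1] [b b1] /=; move: a1 b1; rewrite rk0_1; case: a b => [|a] [|b]. Qed.

Lemma idealP f : I f <-> exists u : 'cV_(rk 1), forall a, (d 0%N *m u) a 0 = f.
Proof. by have [_ _ H _ _] := F_res; apply: H. Qed.

Lemma idealD f g : I f -> I g -> I (f + g).
Proof.
move=> /idealP[u uf] /idealP[v vg]; apply/idealP; exists (u + v) => a.
by rewrite mulmxDr mxE uf vg.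
Qed.

Lemma ideal0 : I 0.
Proof. by apply/idealP; exists 0 => a; rewrite mulmx0 mxE. Qed.

Lemma idealM f g : I g -> I (f * g).
Proof.
by move=> /idealP[v vg]; apply/idealP; exists (f *: v) => a; rewrite -scalemxAr mxE vg.
Qed.

Lemma ideal_d0 a b : I (d 0%N a b).
Proof.
apply/idealP; exists (delta_mx b 0) => a'; rewrite -colE mxE.
by congr (d 0%N _ _); apply: rk0_eq.
Qed.

Lemma ideal_mx m (V : 'M[S]_(rk 0, m)) : (forall a b, I (V a b)) ->
  exists U : 'M_(rk 1, m), d 0%N *m U = V.
Proof.
move=> IV; pose o : 'I_(rk 0) := cast_ord (esym rk0_1) ord0.
have /fin_all_exists[u uP] : forall b, exists u : 'cV_(rk 1),
    forall a, (d 0%N *m u) a 0 = V o b by move=> b; apply/idealP.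
exists (\matrix_(i, j) u j i 0); apply/matrixP => a b.
rewrite (rk0_eq a o) -(uP b o) !mxE.
by apply: eq_bigr => l _; rewrite !mxE.
Qed.

Lemma rk_top : rk e.+1 = 1%N.
Proof. by have [] := gorenstein_top idealD idealM Ihomog d_min d_zhomog F_length r_eq Ext_iso. Qed.

Lemma sh_top (b : 'I_(rk e.+1)) : sh b = (e.+1 + 2)%:Z.
Proof. by have [] := gorenstein_top idealD idealM Ihomog d_min d_zhomog F_length r_eq Ext_iso. Qed.

Lemma ideal_dtop a b : I (d e a b).
Proof. by have [] := gorenstein_top idealD idealM Ihomog d_min d_zhomog F_length r_eq Ext_iso. Qed.

Lemma ideal_top f : I f -> exists w : 'rV_(rk e), forall b, (w *m d e) 0 b = f.
Proof.
by have [_ _ _ H] := gorenstein_top idealD idealM Ihomog d_min d_zhomog F_length r_eq Ext_iso; apply: H.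
Qed.

Lemma rktop_eq (a b : 'I_(rk e.+1)) : a = b.
Proof. by apply/ord_inj; case: a b => [a a1] [b b1] /=; move: a1 b1; rewrite rk_top; case: a b => [|a] [|b]. Qed.

Lemma d_top_inj m (u : 'M_(rk e.+1, m)) : d e *m u = 0 -> u = 0.
Proof.
have [_ rk0] := F_length.
move=> /d_exact_mx[w ->]; apply/matrixP => i j; rewrite !mxE big1 // => -[l ll].
by exfalso; move: ll; rewrite rk0.
Qed.

Lemma coexact_F i : (i <= e)%N -> coexact d i.
Proof.
move=> ie; apply: (coexact_le d_complex d_exact_mx _ d_top_inj _ ie).
  by rewrite rk_top.
move=> a b; have [|U dU] := @ideal_mx _ ((d e a b)%:M).
  move=> i' j; rewrite mxE; case: eqP => _; rewrite ?mulr1n ?mulr0n; first exact: ideal_dtop.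
  exact: ideal0.
by exists U.
Qed.

Lemma const_mulmx_d i p (u : 'M[k]_(rk i.+1, p)) w : [u]S = d i.+1 *m w -> u = 0.
Proof.
move=> uw; apply/matrixP => a b; rewrite [RHS]mxE.
have := congr1 (fun M : 'M[S]_(rk i.+1, p) => (M a b)@_0%MM) uw; rewrite !mxE mcoeffC eqxx mulr1 => ->.
by rewrite raddf_sum big1 // => l _; rewrite /= rmorphM /= d_min mul0r.
Qed.

Lemma const_mulmx_dr i p (u : 'M[k]_(p, rk i.+1)) w : [u]S = w *m d i -> u = 0.
Proof.
move=> uw; apply/matrixP => a b; rewrite [RHS]mxE.
have := congr1 (fun M : 'M[S]_(p, rk i.+1) => (M a b)@_0%MM) uw; rewrite !mxE mcoeffC eqxx mulr1 => ->.
by rewrite raddf_sum big1 // => l _; rewrite /= rmorphM /= d_min mulr0.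
Qed.

Lemma col_neq0 i (b : 'I_(rk i.+1)) : ~ (forall a, d i a b = 0).
Proof.
move=> db; have /d_exact[w wP] : d i *m (delta_mx b 0 : 'cV_(rk i.+1)) = 0.
  by rewrite -colE; apply/matrixP => a j; rewrite !mxE.
have : (delta_mx b 0 : 'cV[k]_(rk i.+1)) = 0.
  by apply: (const_mulmx_d (w := w)); rewrite -wP map_delta_mx.
by move/matrixP/(_ b 0)/eqP; rewrite !mxE !eqxx oner_eq0.
Qed.

Lemma row_neq0 i (a : 'I_(rk i)) : (0 < i <= e)%N -> ~ (forall b, d i a b = 0).
Proof.
case: i a => // i a ie da.
have /(coexact_F ie)[w wP] : (delta_mx 0 a : 'rV_(rk i.+1)) *m d i.+1 = 0.
  by rewrite -rowE; apply/matrixP => l b; rewrite !mxE.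
have : (delta_mx 0 a : 'rV[k]_(rk i.+1)) = 0.
  by apply: (const_mulmx_dr (w := w)); rewrite -wP map_delta_mx.
by move/matrixP/(_ 0 a)/eqP; rewrite !mxE !eqxx oner_eq0.
Qed.

Lemma zhomog_le0 m (f : S) : zhomog m f -> f@_0%MM = 0 -> (m <= 0)%R -> f = 0.
Proof.
by case: m => [[|m]|m] //= /homog0_const fc f0 _; rewrite fc f0 mpolyC0.
Qed.

Lemma zhomog_le1 m (f : S) : zhomog m f -> f@_0%MM = 0 -> I f -> (m <= 1)%R -> f = 0.
Proof.
case: m => [[|[|m]]|m] //= fh f0 If _; last exact: I_nondegenerate.
by rewrite (homog0_const fh) f0 mpolyC0.
Qed.

(** A column of d i with a generator of too small degree would consist of entries of
degree at most 0 (or of linear forms of the ideal for i = 0), hence vanish, which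
contradicts minimality and exactness. *)
Lemma sh_ge i (b : 'I_(rk i.+1)) : (i.+2%:Z <= sh b)%R.
Proof.
have [[_ sh0] _ _ _ _] := F_res.
elim: i b => [|i IHi] b; apply: contraT => shb; exfalso; apply: (@col_neq0 _ b) => a.
  by apply: (zhomog_le1 (d_zhomog a b)); [apply: d_min | apply: ideal_d0 | rewrite sh0; lia].
apply: (zhomog_le0 (d_zhomog a b)); first exact: d_min.
by have := IHi a; lia.
Qed.

(** The dual argument, downwards along rows, starting from the degree e + 3 of the
last generator. *)
Lemma sh_le i (a : 'I_(rk i)) : (0 < i <= e)%N -> (sh a <= i.+1%:Z)%R.
Proof.
move=> ie; move En : (e - i)%N => m; elim: m i a ie En => [|m IHm] i a ie En.
  have Ei : i = e by lia.
  subst i; apply: contraT => sha; exfalso; apply: (row_neq0 ie) => b.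
  apply: (zhomog_le1 (d_zhomog a b)); [exact: d_min | exact: ideal_dtop |].
  by rewrite sh_top; lia.
apply: contraT => sha; exfalso; apply: (row_neq0 ie) => b.
apply: (zhomog_le0 (d_zhomog a b)); first exact: d_min.
have ie' : (0 < i.+1 <= e)%N by lia.
have := IHm i.+1 b ie' _; have -> : (e - i.+1)%N = m by lia.
by move=> /(_ erefl); lia.
Qed.

Lemma sh_eq i (a : 'I_(rk i)) : (0 < i <= e)%N -> sh a = i.+1%:Z.
Proof.
by move=> ie; have := sh_le a ie; case: i a ie => // i a _; have := sh_ge a; lia.
Qed.

Definition d_deg i := if (i == 0%N) || (i == e) then 2%N else 1%N.

Lemma d_homog i a b : d i a b \is (d_deg i).-homog.
Proof.
have [[_ sh0] _ _ _ _] := F_res; have [_ rk0] := F_length.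
have [ie|ie|ie] := ltngtP i e.
- have := d_zhomog a b; rewrite (@sh_eq i.+1) //= /d_deg; case: eqP => [i0|/eqP i0].
    by subst i; rewrite sh0.
  rewrite (ltn_eqF ie) /= sh_eq; last by lia.
  by rewrite (_ : _ - _ = Posz 1); last lia.
- by exfalso; case: b => b bb; move: bb; rewrite rk0 // ltnS.
- subst i; have := d_zhomog a b; rewrite sh_top sh_eq; last by lia.
  by rewrite /d_deg eqxx orbT (_ : _ - _ = Posz 2); last lia.
Qed.

Lemma d_deg_gt0 i : (0 < d_deg i)%N.
Proof. by rewrite /d_deg; case: ifP. Qed.

(** * The self-duality *)

(** For i + j = e + 1, the component from the dual of F_j to F_i of a lift of the
identity; each step chooses a constant solution of the lifting equation, and
components with i + j different from e + 1 are dummies. *)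
Fixpoint dual_map i : forall j, 'M[k]_(rk i, rk j) :=
  match i with
  | 0 => fun j => const_mx 1
  | i'.+1 => fun j => epsilon (inhabits 0)
      (fun B => d i' *m [B]S = [dual_map i' j.+1]S *m (d j)^T)
  end.

(* F_0 and F_(e+1) have rank one, so the matrix of ones is an identity matrix. *)
Lemma dual_map0_mull p (A : 'M[S]_(rk e.+1, p)) a b c : ([dual_map 0 e.+1]S *m A) a b = A c b.
Proof.
rewrite mxE (bigD1 c) //= big1 => [|l /eqP[]]; last exact: rktop_eq.
by rewrite addr0 !mxE mul1r.
Qed.

Lemma d_deg_sym i j : (i + j)%N = e -> d_deg i = d_deg j.
Proof. by rewrite /d_deg => ije; congr (if _ then _ else _); lia. Qed.

(** The matrices d i and d j have the same degree, so the lift can be taken constant. *)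
Lemma dual_map_step i j (A : 'M[k]_(rk i, rk j.+1)) : (i + j)%N = e ->
  (exists U, d i *m U = [A]S *m (d j)^T) -> exists B, d i *m [B]S = [A]S *m (d j)^T.
Proof.
move=> ije [U UP]; exists (const_coef U).
apply: (mulmx_const_coef (@d_homog i) _ UP) => a b.
rewrite -[_ *m _]trmxK trmx_mul trmxK mxE map_trmx (d_deg_sym ije).
by apply: mulmx_const_homog; apply: d_homog.
Qed.

Lemma dual_map_chain i j : (i + j)%N = e ->
  d i *m [dual_map i.+1 j]S = [dual_map i j.+1]S *m (d j)^T.
Proof.
elim: i j => [|i IHi] j ije.
  apply: (epsilon_spec (inhabits (0 : 'M[k]_(rk 1, rk j)))
    (fun B => d 0%N *m [B]S = [dual_map 0 j.+1]S *m (d j)^T)).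
  apply: dual_map_step => //; apply: ideal_mx => a b.
  move: ije; rewrite add0n => je; subst j.
  rewrite (dual_map0_mull _ _ _ (cast_ord (esym rk_top) ord0)) mxE.
  exact: ideal_dtop.
apply: (epsilon_spec (inhabits (0 : 'M[k]_(rk i.+2, rk j)))
  (fun B => d i.+1 *m [B]S = [dual_map i.+1 j.+1]S *m (d j)^T)).
apply: dual_map_step => //.
have /d_exact_mx[U ->] : d i *m ([dual_map i.+1 j.+1]S *m (d j)^T) = 0.
  rewrite mulmxA IHi; last by lia.
  by rewrite -mulmxA -trmx_mul d_complex trmx0 mulmx0.
by exists U.
Qed.

(** A constant matrix killed by d i is a multiple of d i.+1, whose entries lie in the
maximal ideal. *)
Lemma chain_map_unique (rho : forall i j, 'M[k]_(rk i, rk j)) :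
  (forall i j, (i + j)%N = e ->
     d i *m [rho i.+1 j]S = [rho i j.+1]S *m (d j)^T) ->
  rho 0%N e.+1 = 0 -> forall i j, (i + j)%N = e.+1 -> rho i j = 0.
Proof.
move=> rho_chain rho0; elim=> [|i IHi] j ije.
  by move: ije; rewrite add0n => je; subst j.
have ije' : (i + j)%N = e by lia.
have := rho_chain i j ije'; rewrite IHi ?map_mx0 ?mul0mx; last by lia.
by move=> /d_exact_mx[w /const_mulmx_d].
Qed.

(** The transpose of dual_map is again a chain map from the dual complex, so it is a
multiple of dual_map; comparing the two ends gives the square of the scalar. *)
Lemma dual_map_sym : exists2 lam : k, lam * lam = 1 &
  forall i j, (i + j)%N = e.+1 -> (dual_map j i)^T = lam *: dual_map i j.
Proof.
pose o0 : 'I_(rk 0) := cast_ord (esym rk0_1) ord0.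
pose oe : 'I_(rk e.+1) := cast_ord (esym rk_top) ord0.
pose lam := dual_map e.+1 0%N oe o0.
have sym i j : (i + j)%N = e.+1 -> (dual_map j i)^T = lam *: dual_map i j.
  move=> ije; apply/eqP; rewrite -subr_eq0; apply/eqP.
  apply: (chain_map_unique (rho := fun i j => (dual_map j i)^T - lam *: dual_map i j)) ije.
    move=> a b abe; rewrite !map_mxB !map_mxZ mulmxBr mulmxBl -!map_trmx.
    congr (_ - _); last by rewrite -scalemxAr -scalemxAl dual_map_chain.
    by rewrite -[d a]trmxK -!trmx_mul dual_map_chain 1?addnC // trmxK.
  apply/matrixP => a b; rewrite !mxE mulr1 (rktop_eq b oe) (rk0_eq a o0) /lam.
  by rewrite subrr.
exists lam => //.
have /matrixP/(_ oe o0) := sym e.+1 0%N (addn0 _).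
by rewrite !mxE.
Qed.

(** Injectivity and surjectivity say that the entries of d e are a minimal set of
generators of the ideal, as are those of d 0. *)
Lemma dual_map1_inj (v : 'cV[k]_(rk e)) : dual_map 1 e *m v = 0 -> v = 0.
Proof.
move=> pv; have dv : (d e)^T *m [v]S = 0.
  have : [dual_map 0 e.+1]S *m ((d e)^T *m [v]S) = 0.
    by rewrite mulmxA -dual_map_chain ?add0n // -mulmxA -map_mxM pv map_mx0 mulmx0.
  move=> /matrixP H; apply/matrixP => a b.
  by have := H (cast_ord (esym rk0_1) ord0) b; rewrite (dual_map0_mull _ _ _ a) !mxE.
have /(coexact_F (leqnn e)) : ([v]S)^T *m d e = 0.
  by rewrite -[d e]trmxK -trmx_mul dv trmx0.
case: (e) e_gt1 v pv dv => // e' _ v _ _ [w].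
by rewrite map_trmx => /const_mulmx_dr /(congr1 trmx); rewrite trmxK trmx0.
Qed.

Lemma dual_map1_surj (v : 'cV[k]_(rk 1)) : exists w, dual_map 1 e *m w = v.
Proof.
pose o0 : 'I_(rk 0) := cast_ord (esym rk0_1) ord0.
have /ideal_top[w wP] : I ((d 0%N *m [v]S) o0 0).
  by apply/idealP; exists [v]S => a; rewrite (rk0_eq a o0).
pose W := const_coef w^T; exists W.
have dW : (d e)^T *m [W]S = const_mx ((d 0%N *m [v]S) o0 0).
  apply: (mulmx_const_coef (t := d_deg e) (U := w^T)) => [i j|i j|].
  - by rewrite mxE; apply: d_homog.
  - rewrite mxE -(d_deg_sym (add0n e)).
    by apply: mulmx_const_homog; apply: d_homog.
  - by apply/matrixP => b j; rewrite -trmx_mul mxE [RHS]mxE ord1 wP.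
have : d 0%N *m [dual_map 1 e *m W - v]S = 0.
  rewrite map_mxB mulmxBr map_mxM mulmxA dual_map_chain ?add0n // -mulmxA.
  apply/matrixP => a b; rewrite mxE (dual_map0_mull _ _ _ (cast_ord (esym rk_top) ord0)).
  by rewrite dW !mxE ord1 (rk0_eq a o0) subrr.
by move=> /d_exact[u /const_mulmx_d/eqP]; rewrite subr_eq0 => /eqP.
Qed.

Lemma dual_map1_inverse : exists B, dual_map 1 e *m B = 1%:M /\ B *m dual_map 1 e = 1%:M.
Proof.
have /fin_all_exists[w wP] : forall j : 'I_(rk 1),
    exists w : 'cV_(rk e), dual_map 1 e *m w = delta_mx j 0.
  by move=> j; apply: dual_map1_surj.
pose B : 'M_(rk e, rk 1) := \matrix_(i, j) w j i 0.
have pB : dual_map 1 e *m B = 1%:M.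
  apply/matrixP => i j; have /matrixP/(_ i 0) := wP j.
  rewrite !mxE eqxx andbT => <-; by apply: eq_bigr => l _; rewrite mxE.
exists B; split=> //; apply/eqP; rewrite -subr_eq0; apply/eqP/matrixP => i j.
have : dual_map 1 e *m col j (B *m dual_map 1 e - 1%:M) = 0.
  by rewrite colE mulmxA mulmxBr mulmxA pB mul1mx mulmx1 subrr mul0mx.
by move=> /dual_map1_inj/matrixP/(_ i 0); rewrite !mxE.
Qed.

Lemma rk_sym : rk e = rk 1.
Proof.
have [B [pB Bp]] := dual_map1_inverse.
by apply/eqP; rewrite eqn_leq (mulmx1_min Bp) (mulmx1_min pB).
Qed.


Lemma dual_map_top_inverse : exists B, dual_map e 1 *m B = 1%:M.
Proof.
have [lam lam2 sym] := dual_map_sym; have [B [_ Bp]] := dual_map1_inverse.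
exists (lam *: B^T); rewrite -scalemxAr scalemxAl -sym ?addn1 //.
by rewrite -trmx_mul Bp trmx1.
Qed.

(** * The skew-symmetry *)

Local Notation E := (extalg S r.+1).
Local Notation Ek := (extalg k r.+1).
Local Notation "[ A ]E" := (map_mx (in_alg E) A) (format "[ A ]E").
Local Notation lprod := (dprod (@lin_ext k r) d).
Local Notation sprod := (dprod (@diff k r) d).
Local Notation const_mxE := (map_mx (@const_ext k r)).

Definition augment (u : E) : k := (u set0 : S)@_0%MM.

Lemma augment_is_additive : zmod_morphism augment.
Proof. by move=> u v; rewrite /augment extDE extNE mcoeffB. Qed.
HB.instance Definition _ := GRing.isZmodMorphism.Build E k augment augment_is_additive.

Lemma augment_contract u : augment (contract u) = 0.
Proof.
rewrite /augment contractE raddf_sum big1 // => i _.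
by rewrite /= !rmorphM /= mcoeffX mnm1_eq0 mulr0 mul0r.
Qed.

Lemma augment_min i a b u : augment (d i a b *: u) = 0.
Proof. by rewrite /augment extZE rmorphM /= d_min mul0r. Qed.

Lemma augment_nat c : (0 < c)%N -> augment (1 *+ c) != 0.
Proof.
move=> c0; rewrite raddfMn /= /augment ffunE eqxx mcoeff1 eqxx.
by rewrite -(prednK c0).
Qed.

(** This product represents a generator of Tor_(e+1)(S / I, k) in the homology of the
Koszul complex of S / I. *)
Lemma sprod_top_neq0 : sprod 0 e.+1 <> 0.
Proof.
move=> P0.
apply: (@dprod_not_null_homotopic S E (@contract k r) (@diff k r)
  (@contract1 k r) (@diffM k r) (fun t f => f \is t.-homog) (@contract_diff k r)
  rk d d_complex d_deg d_homog (@contract_contract k r) _ k augment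
  augment_contract augment_min augment_nat d_deg_gt0 e.+1 0 1 0 0) => //.
- by move=> i t; apply: exact_ext => u /d_exact.
- by rewrite rk_top.
- by rewrite P0 mul0rn map_mx0 mulmx0 addr0.
Qed.

Lemma d_linear a b : (0 < a)%N -> (b <= e)%N ->
  forall i, (a <= i < b)%N -> forall s t, d i s t \is 1.-homog.
Proof.
move=> a0 be i iab s t; have := d_homog s t; rewrite /d_deg.
have -> : (i == 0%N) || (i == e) = false by lia.
by [].
Qed.

(** The matrix D in the basis of F_e dual to the given basis of F_1. *)
Definition socle_form : 'M[Ek]_(rk 1) := lprod 1 e *m map_mx (in_alg Ek) (dual_map e 1).

Lemma const_socle_form : const_mxE socle_form = sprod 1 e *m [[dual_map e 1]S]E.
Proof. by apply: const_dprod_mul; [lia | apply: d_linear]. Qed.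

(* [dual_map_chain] for the family of matrices over S that [dprod_reversal] takes. *)
Lemma dual_map_chain_S i j : (i + j)%N = e ->
  d i *m (fun i j => [dual_map i j]S) i.+1 j = (fun i j => [dual_map i j]S) i j.+1 *m (d j)^T.
Proof. exact: dual_map_chain. Qed.

Lemma diff_dual_map i j : map_mx (@diff k r) [dual_map i j]S = 0.
Proof. by apply/matrixP => a b; rewrite !mxE; apply: diffC. Qed.

Lemma socle_form_sym_or_skew :
  socle_form^T = socle_form \/ socle_form^T = - socle_form.
Proof.
have [lam lam2 sym] := dual_map_sym.
have [s] := dprod_reversal (@diffM k r) (@diff_anticomm k r) diff_dual_map dual_map_chain_S
  (ltnW e_gt1) (addn1 e) (add1n e).
have DT : (const_mxE socle_form)^T = [[(dual_map e 1)^T]S]E *m (sprod 1 e)^T.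
  by rewrite const_socle_form trmx_mul_in_alg map_trmx.
have const_inj (A B : 'M[Ek]_(rk 1)) : const_mxE A = const_mxE B -> A = B.
  move=> /matrixP AB; apply/matrixP => i j; apply: const_ext_inj.
  by have := AB i j; rewrite !mxE.
have cases : const_mxE socle_form = (const_mxE socle_form)^T \/
             const_mxE socle_form = - (const_mxE socle_form)^T ->
  socle_form^T = socle_form \/ socle_form^T = - socle_form.
  case=> DD; [left | right]; apply: const_inj; first by rewrite -map_trmx.
  by rewrite map_mxN -map_trmx [in RHS]DD opprK.
have phiE : dual_map 1 e = (dual_map e 1)^T \/ dual_map 1 e = - (dual_map e 1)^T.
  have phiE : dual_map 1 e = lam *: (dual_map e 1)^T by rewrite sym ?add1n // scalerA lam2 scale1r.
  move/eqP: lam2; rewrite -expr2 sqrf_eq1 => /orP[]/eqP lamE.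
    by left; rewrite {1}phiE lamE scale1r.
  by right; rewrite {1}phiE lamE scaleN1r.
rewrite -[_ *m _ in X in X -> _]/(sprod 1 e *m [[dual_map e 1]S]E) -const_socle_form => DE.
apply: cases; rewrite DT DE -signr_odd.
case: phiE => ->; case: odd; rewrite ?scale1r ?scaleN1r ?map_mxN ?mulNmx ?opprK.
all: by [left | right].
Qed.

Lemma socle_form_sign_commutes i j :
  sign_commutes (@diff k r) (e - 1) (const_mxE socle_form i j).
Proof.
rewrite const_socle_form mulmx_in_algE; apply: sign_commutes_sum => l.
apply/sign_commutesZ/dprod_sign_commutes; first exact: diff_anticomm.
exact: ltnW.
Qed.

Lemma ext_eq_opp0 (u : E) : u = - u -> u = 0.
Proof.
move=> uN; apply/ffunP => A; rewrite [RHS]ffunE; apply/mpolyP => m; rewrite mcoeff0.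
have /eqP := congr1 (fun v : E => (v A : S)@_m) uN.
rewrite extNE mcoeffN -subr_eq0 opprK -mulr2n -mulr_natl mulf_eq0 (negPf (k_char0 1)).
by move=> /eqP.
Qed.

(** The quadratic form of socle_form at the differentials of the quadrics is the
product of all the differentials, up to a unit. *)
Lemma socle_form_not_sym : socle_form^T <> socle_form.
Proof.
move=> DT; apply: sprod_top_neq0.
pose o0 : 'I_(rk 0) := cast_ord (esym rk0_1) ord0.
pose oe : 'I_(rk e.+1) := cast_ord (esym rk_top) ord0.
have [lam lam2 sym] := dual_map_sym.
have lam0 : lam != 0 by apply: contra_eq_neq lam2 => ->; rewrite mul0r eq_sym oner_neq0.
have phiE : dual_map e.+1 0%N oe o0 = lam.
  by have /matrixP/(_ o0 oe) := sym 0%N e.+1 erefl; rewrite !mxE mulr1.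
have DTS : (const_mxE socle_form)^T = const_mxE socle_form by rewrite map_trmx DT.
have quad : map_mx (@diff k r) (d 0) *m const_mxE socle_form *m
    (map_mx (@diff k r) (d 0))^T = sprod 0 e.+1 *m [[dual_map e.+1 0%N]S]E.
  rewrite const_socle_form dprodSr // (@dprodSl _ _ _ rk d 0) ?(ltnW e_gt1) //.
  have := diff_phi_chain (@diffM k r) diff_dual_map dual_map_chain_S (addn0 e).
  by rewrite -!mulmxA => <-.
apply/matrixP => i j; rewrite (rk0_eq i o0) (rktop_eq j oe) [RHS]mxE.
have := ext_eq_opp0 (quadratic_form_alternates (@diff_anticomm k r) (d 0%N) o0
  socle_form_sign_commutes DTS).
rewrite quad mulmx_in_algE (bigD1 oe) //= big1 => [|l /eqP[]]; last exact: rktop_eq.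
rewrite addr0 mxE phiE => /(congr1 (fun u : E => (lam^-1)%:MP_[r.+1] *: u)).
by rewrite scalerA -mpolyCM mulVf // scale1r scaler0.
Qed.

Lemma socle_form_skew : socle_form^T = - socle_form.
Proof. by case: socle_form_sym_or_skew => // /socle_form_not_sym. Qed.

(** * Linear syzygies among the quadrics *)

Lemma syzygy_of_colE a (u : 'cV[Ek]_(rk 1)) :
  syzygy_of_col (d 0%N a) u = ([d 0%N]E *m const_mxE u) a 0 :> E.
Proof.
rewrite in_alg_mulmxE; apply/ffunP => A; rewrite ffunE ext_sumE; apply: eq_bigr => i _.
by rewrite extZE mxE const_extE mulrC mul_mpolyC.
Qed.

Lemma contract_syzygy_of_col a (u : 'cV[Ek]_(rk 1)) :
  contract (syzygy_of_col (d 0%N a) u) =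
  ([d 0%N]E *m map_mx (@contract k r) (const_mxE u)) a 0.
Proof.
rewrite syzygy_of_colE.
have := contract_in_alg (@contract k r : {linear E -> E}) (d 0%N) (const_mxE u).
by move/matrixP/(_ a 0); rewrite mxE.
Qed.

Lemma syzygy_of_col_sum m (Q : 'I_(rk 1) -> S) (D : 'M[Ek]_(rk 1, m)) (c : 'cV[k]_m) :
  syzygy_of_col Q (D *m map_mx (in_alg Ek) c) =
  \sum_j (c j 0)%:MP_[r.+1] *: (syzygy_of_col Q (col j D) : E).
Proof.
apply/ffunP => A; rewrite ext_sumE ffunE.
under [RHS]eq_bigr => j _ do rewrite extZE ffunE mulr_sumr.
rewrite exchange_big /=; apply: eq_bigr => i _.
have -> := @mulmx_in_algE k Ek _ _ _ D c i 0.
rewrite ext_sumE scaler_suml; apply: eq_bigr => j _.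
by rewrite extZE mxE mul_mpolyC scalerA.
Qed.

Lemma quadrics_basis a : degree_basis I 2 (d 0%N a).
Proof.
have d2 b : d 0%N a b \is 2.-homog by have := d_homog a b.
have lin_d (c : 'cV[k]_(rk 1)) a' : (d 0%N *m [c]S) a' 0 = \sum_i c i 0 *: d 0%N a i.
  rewrite (rk0_eq a' a) mxE; apply: eq_bigr => i _.
  by rewrite mxE mulrC mul_mpolyC.
split=> [b|c cd i|f /idealP[u uf] f2]; first by split; [apply: ideal_d0 | apply: d2].
  have /d_exact[w /const_mulmx_d] : d 0%N *m [\col_i c i]S = 0.
    apply/matrixP => a' j; rewrite ord1 lin_d [RHS]mxE -[RHS]cd.
    by apply: eq_bigr => l _; rewrite mxE.
  by move/matrixP/(_ i 0); rewrite !mxE.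
exists (fun i => const_coef u i 0); rewrite -(lin_d _ a).
have -> : d 0%N *m [const_coef u]S = const_mx f.
  apply: (mulmx_const_coef (t := 2) (U := u)) => [a' b|a' b|].
  - by rewrite (rk0_eq a' a).
  - by rewrite mxE.
  - by apply/matrixP => a' j; rewrite ord1 uf mxE.
by rewrite mxE.
Qed.

Lemma in_alg_mulmx p q m (A : 'M[k]_(p, q)) (B : 'M[k]_(q, m)) :
  map_mx (in_alg Ek) (A *m B) = map_mx (in_alg Ek) A *m map_mx (in_alg Ek) B.
Proof. exact: (map_mxM (in_alg Ek)). Qed.

(** M stands for a change of basis of F_e. *)
Lemma dprod_represents a m (M : 'M[k]_(rk e, m)) :
  (forall c : 'cV[k]_(rk e), exists c', c = M *m c') ->
  represents_linear_syzygies I (d 0%N a) e (lprod 1 e *m map_mx (in_alg Ek) M).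
Proof.
move=> M_surj; split=> [|w]; first exact: quadrics_basis.
have [QI Qfree Qspan] := quadrics_basis a.
have e0 : (0 < e)%N by exact: ltnW.
split=> [[wdeg wI kw]|[c ->]].
  have /fin_all_exists[c cP] : forall A : {set 'I_r.+1}, exists c : 'I_(rk 1) -> k,
      w A = \sum_i c i *: d 0%N a i.
    by move=> A; have [wAI wA2] := wI A; apply: Qspan.
  pose u : 'cV[Ek]_(rk 1) := \col_i ([ffun A : {set 'I_r.+1} =>
    if #|A| == e.-1 then c A i else 0] : exterior k r.+1).
  have wu : w = syzygy_of_col (d 0%N a) u.
    apply/ffunP => A; rewrite [RHS]ffunE.
    under eq_bigr => i _ do rewrite mxE ffunE.
    case: eqP => [_|/eqP An]; first exact: cP.
    by rewrite wdeg // big1 // => i _; rewrite scale0r.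
  have [||i A An||c' uc'] := @constant_syzygy_dprod k r rk d d_exact d_deg d_homog k_char0 e.-1 0 e u.
  - by rewrite addn1 prednK.
  - by move=> i ie; rewrite /d_deg; have -> : (i == 0%N) || (i == e) = false by lia.
  - by rewrite mxE ffunE (negPf An).
  - apply/matrixP => a' j; rewrite ord1 (rk0_eq a' a) -contract_syzygy_of_col -wu [RHS]mxE.
    exact: kw.
  have [c2 c2P] := M_surj c'; exists (fun j => c2 j 0).
  by rewrite wu uc' c2P in_alg_mulmx mulmxA; apply: syzygy_of_col_sum.
pose c2 : 'cV[k]_m := \col_i c i.
pose u := lprod 1 e *m map_mx (in_alg Ek) (M *m c2).
have wu : \sum_j (c j)%:MP_[r.+1] *: (syzygy_of_col (d 0%N a)
    (col j (lprod 1 e *m map_mx (in_alg Ek) M)) : E) = syzygy_of_col (d 0%N a) u.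
  have -> : u = (lprod 1 e *m map_mx (in_alg Ek) M) *m map_mx (in_alg Ek) c2.
    by rewrite /u in_alg_mulmx mulmxA.
  by rewrite syzygy_of_col_sum; apply: eq_bigr => j _; rewrite mxE.
rewrite wu; split=> [A An|A|].
- rewrite ffunE big1 // => i _; rewrite /u (@mulmx_in_algE k Ek) ext_sumE big1 ?scale0r // => l _.
  by rewrite extZE (dprod_lin_degree _ _ _ e0) ?mulr0 // subn1.
- split; rewrite ffunE.
    elim/big_ind: _ => [|f g If Ig|i _]; last by rewrite -mul_mpolyC; apply/idealM/ideal_d0.
      exact: ideal0.
    exact: idealD.
  by apply: rpred_sum => i _; apply: rpredZ; have [] := QI i.
have -> : koszul (syzygy_of_col (d 0%N a) u) = contract (syzygy_of_col (d 0%N a) u) by [].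
rewrite contract_syzygy_of_col /u const_dprod_mul //; last exact: d_linear.
rewrite (contract_diff_prod d_exact d_homog) // mulmxMnr mulmxA -map_mxM d_complex.
by rewrite map_mx0 mul0mx mul0rn mxE.
Qed.

End GorensteinResolution.

(** * Change of bases *)

Lemma wedge_syzE (k : fieldType) (r : nat) (rk : nat -> nat)
    (d : forall i, 'M[polyS k r]_(rk i, rk i.+1)) p :
  wedge_syz d p.+2 = dprod (@lin_ext k r) d 1 p.+2 :> 'M[extalg k r.+1]_(_, _).
Proof.
elim: p => [|p IHp]; rewrite dprodSr //; first by rewrite dprodnn mul1mx.
by rewrite -IHp; apply/matrixP => i j; rewrite !mxE.
Qed.

Lemma eq_dprod (S : Type) (E : nzRingType) (diff : S -> E) (rk : nat -> nat)
    (d d' : forall i, 'M[S]_(rk i, rk i.+1)) a b :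
  (a <= b)%N -> (forall i, (a <= i < b)%N -> d i = d' i) ->
  dprod diff d a b = dprod diff d' a b.
Proof.
elim: b => [|b IHb]; first by rewrite leqn0 => /eqP-> _; rewrite !dprodnn.
rewrite leq_eqVlt => /orP[/eqP->|]; first by rewrite !dprodnn.
rewrite ltnS => ab dd'; rewrite !dprodSr // dd' ?ab ?ltnSn // IHb // => i /andP[ai ib].
by apply: dd'; rewrite ai ltnW.
Qed.

Lemma lin_ext_mulmx_const (k : fieldType) (r p q s : nat)
    (A : 'M[polyS k r]_(p, q)) (M : 'M[k]_(q, s)) :
  map_mx (@lin_ext k r) (A *m map_mx (@mpolyC r.+1 k) M) =
  map_mx (@lin_ext k r) A *m map_mx (in_alg (extalg k r.+1)) M.
Proof.
apply/matrixP => i j; rewrite !mxE raddf_sum; apply: eq_bigr => l _; rewrite !mxE.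
rewrite mulr_algr mulrC mul_mpolyC; apply/ffunP => B.
rewrite extZE !ffunE mulr_sumr; apply: eq_bigr => h _.
by case: eqP => _; rewrite ?mcoeffZ ?mulr0.
Qed.

Lemma family_at (V : nat -> Type) (v0 : forall i, V i) m (v : V m) :
  exists f : forall i, V i, f m = v /\ forall i, i != m -> f i = v0 i.
Proof.
exists (fun i => if @eqP _ m i is ReflectT E then ecast i (V i) E v else v0 i); split.
  by case: eqP => // E; rewrite (eq_irrelevance E erefl).
by move=> i im; case: eqP => // E; rewrite E eqxx in im.
Qed.

Lemma castmx_mul_const (k : fieldType) (r p q m : nat) (E : q = m)
    (A : 'M[extalg k r.+1]_(p, q)) (B : 'M[k]_(q, m)) :
  castmx (erefl, E) (A *m map_mx (in_alg _) (castmx (erefl, esym E) B)) =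
  A *m map_mx (in_alg _) B.
Proof. by move: A B; case: m / E => A B; rewrite !castmx_id. Qed.

(** Only the last basis is changed, which multiplies D on the right. *)
Lemma wedge_syz_rebased (k : fieldType) (r : nat) (rk : nat -> nat)
    (d d' : forall i, 'M[polyS k r]_(rk i, rk i.+1)) (h : forall i, 'M[k]_(rk i)) e :
  (1 < e)%N -> (forall i, i != e -> h i = 1%:M) ->
  (forall i, i != e -> d' i = d i *m map_mx (@mpolyC r.+1 k) (h i.+1)) ->
  wedge_syz d' e =
    dprod (@lin_ext k r) d 1 e *m map_mx (in_alg (extalg k r.+1)) (h e).
Proof.
case: e => [|[|p]] // _ h1 d'E.
rewrite wedge_syzE dprodSr // [in RHS]dprodSr // (@eq_dprod _ _ _ rk d' d) //.
  rewrite d'E; last by rewrite neq_ltn ltnSn.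
  by rewrite lin_ext_mulmx_const mulmxA.
move=> i ip; rewrite d'E; last by lia.
by rewrite h1 ?map_mx1 ?mulmx1 //; lia.
Qed.

Lemma castmx_unit (k : fieldType) (q m : nat) (E : q = m)
    (A : 'M[k]_(q, m)) (B : 'M[k]_(m, q)) :
  A *m B = 1%:M -> castmx (erefl, esym E) A \in unitmx.
Proof. by move: A B; case: m / E => A B /mulmx1_unit[]; rewrite castmx_id. Qed.

Theorem theorem2 (k : closedFieldType) (k_char0 : [pchar k] =i pred0)
    (r n e : nat) (e_ge3 : (3 <= e)%N)
    (X : projset k r) (F : gfree_complex k r)
    (F_res : minimal_free_resolution (hideal X) F)
    (X_dp : del_pezzo X F n e) :
  exists g : forall i, 'M[{mpoly k[r.+1]}]_(fc_rk F i),
    let d := rebased g in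
    let D := wedge_syz d e.-1 in
    [/\ g 0%N = 1%:M,
        forall i, (1 <= i <= e.-1)%N -> homogeneous_basis (g i),
        forall i, (1 <= i < e.-1)%N -> forall a b, d i a b \is 1.-homog,
        (forall a, represents_linear_syzygies (hideal X) (d 0%N a) e.-1 D)
      & exists sq : fc_rk F e.-1 = fc_rk F 1%N,
          let D' := castmx (erefl (fc_rk F 1%N), sq) D in
          D'^T = - D'].
Proof.
have char0 m : m.+1%:R != 0 :> k.
  by rewrite (proj1 (pcharf0P _) k_char0).
have Ihomog j f : hideal X f -> hideal X (pihomog mdeg j f).
  move=> If i v Xv; have [->|ij] := eqVneq i j; first by rewrite pihomog_id; apply: If.
  rewrite (_ : pihomog _ i _ = 0) ?meval0 //.
  by apply: pihomog_ne0 (pihomogP _ _ _); rewrite eq_sym.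
case: X_dp => _ _ r_eq _ I_nondeg _ _ [F_length Ext_iso].
case: e e_ge3 r_eq F_length Ext_iso => // e e_gt1 r_eq F_length Ext_iso.
rewrite ltnS in e_gt1; rewrite [e.+1.-1]/=.
have e_neq0 : 0%N != e by lia.
have e_neq1 : 1%N != e by lia.
(* After the shift of e, the basis that changes is that of F_e: it becomes the image
of the dual basis of F_1 under the self-duality. *)
have sq := rk_sym F_res Ihomog I_nondeg F_length r_eq Ext_iso e_gt1.
have [B pB] := dual_map_top_inverse F_res Ihomog I_nondeg F_length r_eq Ext_iso e_gt1.
pose M := castmx (erefl, esym sq) (dual_map F e 1).
have M_unit : M \in unitmx := castmx_unit sq pB.
pose V i := 'M[k]_(fc_rk F i).
have [h [he h1]] := @family_at V (fun i => 1%:M) e M.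
pose g i := map_mx (@mpolyC r.+1 k) (h i).
have g1 i : i != e -> g i = 1%:M by move=> ie; rewrite /g h1 // map_mx1.
have dE i : i != e -> rebased g i = fc_d F i *m g i.+1.
  by move=> ie; rewrite /rebased g1 // invmx1 mul1mx.
have dE1 i : i != e -> i.+1 != e -> rebased g i = fc_d F i.
  by move=> ie ie'; rewrite dE // g1 // mulmx1.
have d_lin := d_linear F_res Ihomog I_nondeg F_length r_eq Ext_iso e_gt1.
have DE : wedge_syz (rebased g) e =
    dprod (@lin_ext k r) (fc_d F) 1 e *m map_mx (in_alg (extalg k r.+1)) M.
  by rewrite -he; apply: wedge_syz_rebased.
exists g; split.
- by rewrite g1.
- move=> i ie; split.
    have [->|ie'] := eqVneq i e; last by rewrite g1 // unitmx1.
    have /mulmx1_unit[] // : g e *m map_mx (@mpolyC r.+1 k) (invmx M) = 1%:M.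
    by rewrite /g he -map_mxM mulmxV // map_mx1.
  exists (fun=> i.+1%:Z) => a b; rewrite /g mxE; apply: zhomogC.
  by rewrite (sh_eq F_res Ihomog I_nondeg F_length r_eq Ext_iso e_gt1) // subrr.
- move=> i /andP[i0 ie] a b; rewrite dE; last by rewrite ltn_eqF.
  by apply: mulmx_const_homog => s t; apply: (d_lin i e) => //; rewrite leqnn.
- move=> a; rewrite dE1 // DE.
  apply: (dprod_represents char0 F_res Ihomog I_nondeg F_length r_eq Ext_iso e_gt1).
  by move=> c; exists (invmx M *m c); rewrite mulmxA mulmxV // mul1mx.
exists sq; rewrite DE castmx_mul_const.
exact: (socle_form_skew char0 F_res Ihomog I_nondeg F_length r_eq Ext_iso e_gt1).
Qed.
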